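(* Let $\Omega\subset\mathbb{R}^n$ be measurable with $|\Omega|<\infty$. Let $1\leqslant p,q<\infty$ and $\theta>0$, and let $p',q'$ be the conjugate exponents of $p,q$. Then $$\|f\|_{GL_{p,q}^\theta(\Omega)}\asymp\sup_{\|g\|_{GL_{p',q'}^{-\theta}(\Omega)}=1}\int_\Omega f(x)g(x)\,dx,$$ that is, $$GL_{p,q}^\theta(\Omega)=\left(GL_{p',q'}^{-\theta}(\Omega)\right)',$$ where $(\cdot)'$ denotes the Köthe dual (associate) space.
   Context: $f^*$ denotes the non-increasing rearrangement of a measurable function $f$ on $\Omega$. For $\theta\in\mathbb{R}$, $0<p\leqslant\infty$, $0<q\leqslant\infty$, the grand Lorentz space $GL_{p,q}^{\theta}(\Omega)$ is the set of measurable $f$ on $\Omega$ for which the quasinorm $\|f\|_{GL_{p,q}^\theta(\Omega)}$ is finite, where for $\theta\geqslant 0$ $$\|f\|_{GL_{p,q}^\theta(\Omega)}=\sup_{0<\varepsilon<1}\varepsilon^{\theta}\left(\int_0^1\left(t^{\frac1p+\varepsilon}f^*(t|\Omega|)\right)^q\frac{dt}{t}\right)^{1/q},$$ for $\theta>0$ and $p=\infty$ $$\|f\|_{GL_{\infty,q}^\theta(\Omega)}=\sup_{0<\varepsilon<1}\varepsilon^{\theta}\left(\int_0^1\left(t^{\varepsilon}f^*(t|\Omega|)\right)^q\frac{dt}{t}\right)^{1/q},$$ and for $\theta<0$ $$\|f\|_{GL_{p,q}^\theta(\Omega)}=\inf_{0<\varepsilon<\frac1p}\varepsilon^{\theta}\left(\int_0^1\left(t^{\frac1p-\varepsilon}f^*(t|\Omega|)\right)^q\frac{dt}{t}\right)^{1/q};$$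 when $q=\infty$ the expression $(\int_0^1(\cdot)^q\frac{dt}{t})^{1/q}$ is replaced by $\sup_{0<t<1}(\cdot)$. The Köthe dual $X'$ of such a space $X$ is the set of measurable $f$ on $\Omega$ with $\sup_{\|g\|_X=1}\int_\Omega|f(x)g(x)|\,dx<\infty$; equality of spaces is meant as sets with equivalent (quasi)norms. $A\asymp B$ means that $A\leqslant CB$ and $B\leqslant CA$ for some constant $C>0$ independent of the primary parameters under consideration, in particular of $f$.
   Formalization: Proved for 1<p<∞ instead of 1≤p<∞: at p=1 one has p'=∞, and the infimum over 0<ε<1/p'=0 defining the norm of GL_{∞,q'}^{-θ} is over the empty set, so no g has norm 1 and the claim fails, e.g. for f=1 on Ω with |Ω|>0. *)

(* Defs.v *)
From HB Require Import structures.
From mathcomp Require Import all_boot all_order all_algebra.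
From mathcomp Require Import all_classical all_reals all_analysis.

Set Implicit Arguments.
Unset Strict Implicit.
Unset Printing Implicit Defensive.

Import Order.TTheory GRing.Theory Num.Theory.
Import numFieldNormedType.Exports.

Local Open Scope classical_set_scope.
Local Open Scope ring_scope.
Local Open Scope ereal_scope.

(* Lebesgue measure on R^n is not in the library.  On the Borel sets it is
   built by recursion on n as the iterated product of the one-dimensional
   [lebesgue_measure], transported along R * R^n -> R^n.+1; it is then completed,
   so that "measurable" below means Lebesgue measurable. *)
Section tuple_product_measure.
Context d (T : measurableType d) (R : realType) (n : nat).
Variables (m1 : {sigma_finite_measure set T -> \bar R})
  (m : {sigma_finite_measure set (n.-tuple T) -> \bar R}).

Definition cons_pair (x : T * n.-tuple T) : n.+1.-tuple T :=
  [tuple of x.1 :: x.2].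

Definition product_tuple : set (n.+1.-tuple T) -> \bar R :=
  pushforward (m1 \x m) cons_pair.

Let preimage_measurable A : measurable A -> measurable (cons_pair @^-1` A).
Proof.
move=> mA; rewrite -[X in measurable X]setTI.
by have /(_ measurableT _ mA) : measurable_fun setT cons_pair
  by exact: measurable_cons.
Qed.

Let product_tuple0 : product_tuple set0 = 0.
Proof. by rewrite /product_tuple /pushforward preimage_set0 measure0. Qed.

Let product_tuple_ge0 A : 0 <= product_tuple A.
Proof. by apply: integral_ge0 => x _; exact: measure_ge0. Qed.

Let product_tuple_sigma_additive : semi_sigma_additive product_tuple.
Proof.
move=> F mF tF mUF; rewrite /product_tuple /pushforward preimage_bigcup.
apply: measure_semi_sigma_additive.
- by move=> k; exact: preimage_measurable.
- apply/trivIsetP => /= i j _ _ ij; rewrite -preimage_setI.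
  by move/trivIsetP : tF => /(_ _ _ _ _ ij) ->//; rewrite preimage_set0.
- by rewrite -preimage_bigcup; exact: preimage_measurable.
Qed.

HB.instance Definition _ := isMeasure.Build _ _ _ product_tuple
  product_tuple0 product_tuple_ge0 product_tuple_sigma_additive.

Let product_tuple_sigma_finite : sigma_finite setT product_tuple.
Proof.
have /sigma_finiteP[F [TF ndF Foo]] := sigma_finiteT m1.
have /sigma_finiteP[G [TG ndG Goo]] := sigma_finiteT m.
pose tl (v : n.+1.-tuple T) := (thead v, [tuple of behead v]).
have mtl : measurable_fun setT tl.
  apply/measurable_fun_pairP; split; first exact: measurable_tnth.
  exact: measurable_behead.
have consK : cancel cons_pair tl by move=> [x v]; congr pair; apply: val_inj.
exists (fun k => tl @^-1` (F k `*` G k)).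
  rewrite -preimage_bigcup (_ : \bigcup_k _ = setT) ?preimage_setT//.
  rewrite -subTset => -[x y] _.
  have [i _ Fx] : (\bigcup_i F i) x by rewrite -TF.
  have [j _ Gy] : (\bigcup_i G i) y by rewrite -TG.
  exists (maxn i j) => //; split => /=.
  - by move: x Fx; exact/subsetPset/ndF/leq_maxl.
  - by move: y Gy; exact/subsetPset/ndG/leq_maxr.
move=> k; have [mF Fk] := Foo k; have [mG Gk] := Goo k; split.
  by rewrite -[X in measurable X]setTI; apply: mtl => //; exact: measurableX.
rewrite /product_tuple /pushforward -comp_preimage.
rewrite (_ : tl \o _ = id); last by apply/funext => x; exact: consK.
by rewrite preimage_id product_measure1E// lte_mul_pinfty// ge0_fin_numE.
Qed.

HB.instance Definition _ := Measure_isSigmaFinite.Build _ _ _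
  product_tuple product_tuple_sigma_finite.

End tuple_product_measure.

Section lebesgue_Rn.
Variable R : realType.

Fixpoint borel_lebesgue n :
    {sigma_finite_measure set (n.-tuple (measurableTypeR R)) -> \bar R} :=
  match n with
  | 0 => \d_([tuple] : 0.-tuple (measurableTypeR R))
  | k.+1 => product_tuple (@lebesgue_measure R) (borel_lebesgue k)
  end.

Definition Rn n : measurableType _ :=
  caratheodory_type ((borel_lebesgue n)^*)%mu.

Definition lebesgue_Rn n : {measure set (Rn n) -> \bar R} :=
  @completed_measure_extension _ _ _ (borel_lebesgue n).

End lebesgue_Rn.

Section function_spaces.
Context d (T : measurableType d) (R : realType).
Variables (mu : {measure set T -> \bar R}) (D : set T).
Implicit Types (f g : T -> R) (N M : (T -> R) -> \bar R) (X Y : set (T -> R)).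

Definition rearrangement f (t : \bar R) : \bar R :=
  ereal_inf [set s%:E | s in
    [set s : R | (0 <= s)%R /\ mu (D `&` [set x | (s < `|f x|)%R]) <= t]].

Definition lorentz_integral (a : R) (q : \bar R) f : \bar R :=
  let F (t : R) := (t `^ a)%:E * rearrangement f (t%:E * mu D) in
  match q with
  | r%:E => (\int[@lebesgue_measure R]_(t in `]0%R, 1%R[)
               (F t `^ r * (t^-1)%:E)) `^ r^-1
  | _ => ereal_sup [set F t | t in `]0%R, 1%R[]
  end.

(* [fine p^-1] is 1/p, with value 0 for p = +oo.  For theta < 0 and p = +oo the
   infimum is over the empty set, so the quasinorm is identically +oo. *)
Definition GLnorm (theta : R) (p q : \bar R) f : \bar R :=
  if (0 <= theta)%R then
    ereal_sup [set (e `^ theta)%:E * lorentz_integral (fine p^-1 + e) q f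
              | e in [set e : R | (0 < e < 1)%R]]
  else
    ereal_inf [set (e `^ theta)%:E * lorentz_integral (fine p^-1 - e) q f
              | e in [set e : R | (0 < e < fine p^-1)%R]].

Definition GL (theta : R) (p q : \bar R) : set (T -> R) :=
  [set f | measurable_fun D f /\ GLnorm theta p q f < +oo].

(* Suprema of (semi)norms are taken in [0, +oo]: the supremum of the empty
   family is 0, whereas [ereal_sup set0] is -oo. *)
Definition sup_ge0 (A : set (\bar R)) : \bar R := maxe 0 (ereal_sup A).

(* [X] is the underlying set of a quasinormed space and [N] its quasinorm. *)
Definition koethe_norm X N f : \bar R :=
  sup_ge0 [set \int[mu]_(x in D) `|f x * g x|%:E | g in
    [set g | X g /\ N g = 1]].

(* If the integral of f g has the form oo - oo, its value is -oo and it does not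
   contribute to the supremum. *)
Definition pairing_norm X N f : \bar R :=
  sup_ge0 [set \int[mu]_(x in D) (f x * g x)%:E | g in
    [set g | X g /\ N g = 1]].

Definition koethe_dual X N : set (T -> R) :=
  [set f | measurable_fun D f /\ koethe_norm X N f < +oo].

Definition norm_equiv (F : set (T -> R)) N M : Prop :=
  exists2 C : R, (0 < C)%R &
    forall f, F f -> N f <= C%:E * M f /\ M f <= C%:E * N f.

Definition eq_space X N Y M : Prop := X = Y /\ norm_equiv X N M.

End function_spaces.

(* Main.v *)
Require Import Defs.
From mathcomp Require Import all_boot all_order all_algebra.
From mathcomp Require Import all_classical all_reals all_analysis.
From mathcomp Require Import measurable_realfun.
From mathcomp Require Import ring.

Set Implicit Arguments.
Unset Strict Implicit.
Unset Printing Implicit Defensive.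

Import Order.TTheory GRing.Theory Num.Theory.
Import numFieldNormedType.Exports.

Local Open Scope classical_set_scope.
Local Open Scope ring_scope.
Local Open Scope ereal_scope.

(** Write f#(t) for the decreasing rearrangement of f at the point t |D|, with
t in (0,1), and L_a(f) for the norm of t^a f# in L^q(dt/t), so that the norm N
of the theorem is the supremum of e^theta L_(1/p + e)(f) over 0 < e < 1, and
the norm M of its predual is the infimum of e^(-theta) L'_(1/p' - e)(g) over
0 < e < 1/p', where L' is L for the exponent q'.

The integral of |f g| is at most N(f) M(g), up to |D|. The Hardy-Littlewood
inequality bounds it by |D| times the integral of f# g#, and for each e the
factorization f# g# = (t^(1/p + e) f#) (t^(1/p' - e) g#) and the inequality of
Hoelder for dt/t bound that by
  (e^theta L_(1/p + e)(f)) (e^(-theta) L'_(1/p' - e)(g)),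
because the powers of e cancel. The first factor is at most N(f), and the
infimum of the second one over e is M(g) ([integral_le_GLnorm]).

Conversely, fix e, put a = 1/p + e, and look for g such that the pairing of f
with g recovers L_a(f) and L'_(1 - a)(g) is controlled; then M(g) is at most
e^(-theta) L'_(1 - a)(g), and the powers of e cancel again. The equality case
of the Hoelder inequality suggests g# = t^(aq - 1) f#^(q - 1), but that
function need not decrease. It is replaced by a decreasing h which dominates it
up to a constant and still has a controlled norm ([dual_profile]): h^q' is the
integral over (t/2, 1) of a suitable weight times f#^q, so that Tonelli's
theorem computes its norm. The function g itself is sgn(f) h(tau(|f|)), where
tau(s) is the length of the set where f# is at least s ([plateau_end]). Since g
depends on f only, all integrals are computed on (0,1) from the
equimeasurability of |f| and f#. As tau(f#(t)) is at least t, with strict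
inequality inside the plateaus of f#, one gets g# <= h at once; that the
pairing loses only a constant when t is replaced by tau(f#(t)) is
[le_integral_plateau_end].

The constants so obtained depend on a lower bound for 1 - a only. Hence the
argument is run for e <= (1 - 1/p)/2; larger e reduce to that value
because t^e decreases with e on (0,1) ([GLnorm_le_pairing]). Two technical
points remain. To divide by a finite quantity, f# is first truncated at height
n, and n tends to infinity at the end. And g can be normalized only if M(g) is
not 0; otherwise the first estimate, with the constant function 1 in the place
of f, shows that g vanishes almost everywhere ([integral_le_pairing_norm]). *)

(** * Layer cake formulas *)

Lemma measurable_superlevel d (T : measurableType d) (R : realType) (D : set T)
    (f : T -> R) (s : R) : measurable D -> measurable_fun D f ->
  measurable (D `&` [set x | (s < f x)%R]).
Proof.
move=> mD mf; rewrite (_ : [set x | _] = f @^-1` `]s, +oo[%classic).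
  exact: mf.
by apply/seteqP; split => x /=; rewrite in_itv/= andbT.
Qed.

Section layer_cake.
Context d (T : measurableType d) (R : realType).
Variables (mu : {measure set T -> \bar R}) (D : set T).
Hypotheses (mD : measurable D) (Dfin : mu D < +oo).
Local Notation leb := (@lebesgue_measure R).

Let nu : {finite_measure set T -> \bar R} := mfrestr mD Dfin.

Let nuE (f : T -> \bar R) : \int[nu]_(x in D) f x = \int[mu]_(x in D) f x.
Proof.
by apply: eq_measure_integral => A mA AD; rewrite /nu/= /mfrestr/= /mrestr
  setIidl.
Qed.

Let nuET (f : T -> \bar R) : \int[nu]_x (f \_ D) x = \int[mu]_(x in D) f x.
Proof. by rewrite -integral_mkcond nuE. Qed.

(** Tonelli's theorem on the region 0 < s < phi(x). With [w] = 1 and [k] = 1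
    this is the usual layer cake formula; the weights serve for the
    Hardy-type estimate of [integral_dual_profile_le]. *)
Lemma layer_cake (k : T -> \bar R) (w : R -> \bar R) (phi : T -> R) :
  measurable_fun D k -> (forall x, D x -> 0 <= k x) ->
  measurable_fun setT w -> (forall s, 0 <= w s) ->
  measurable_fun D phi ->
  \int[mu]_(x in D) (k x * \int[leb]_(s in `]0%R, phi x[) w s) =
  \int[leb]_(s in `]0%R, +oo[)
    (w s * \int[mu]_(x in D `&` [set x | (s < phi x)%R]) k x).
Proof.
move=> mk k0 mw w0 mphi.
pose k' := k \_ D; pose phi' := phi \_ D.
have mk' : measurable_fun setT k' by apply/(measurable_restrictT _ mD).
have mphi' : measurable_fun setT phi' by apply/(measurable_restrictT _ mD).
have k'0 x : 0 <= k' x.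
  by rewrite /k' patchE; case: ifPn => // /[!inE]/k0.
pose i (z : T * R) : R := ((0 < z.2) && (z.2 < phi' z.1))%:R%R.
pose G (z : T * R) := k' z.1 * (w z.2 * (i z)%:E).
have mi : measurable_fun setT i.
  rewrite (_ : i = \1_((fun z : T * R => (0 < z.2)%R && (z.2 < phi' z.1)%R)
    @^-1` [set true])).
    apply: measurable_indic; rewrite -[X in measurable X]setTI.
    apply: (measurable_and (f := fun z : T * R => (0 < z.2)%R)) => //.
    - by apply: measurable_fun_ltr => //; exact: measurable_snd.
    - apply: measurable_fun_ltr; first exact: measurable_snd.
      by apply: measurableT_comp => //; exact: measurable_fst.
  apply/funext => z; rewrite indicE /i; congr (_%:R : R); congr nat_of_bool.
  by apply/idP/idP; rewrite inE/=.
have mG : measurable_fun setT G.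
  apply: emeasurable_funM; first by apply: measurableT_comp => //;
    exact: measurable_fst.
  apply: emeasurable_funM; first by apply: measurableT_comp => //;
    exact: measurable_snd.
  exact/measurable_EFinP.
have i0 z : 0 <= (i z)%:E by rewrite lee_fin /i.
have G0 z : 0 <= G z by rewrite /G !mule_ge0.
have := @fubini_tonelli _ _ _ _ _ nu leb G mG G0.
have -> : \int[nu]_x \int[leb]_y G (x, y) =
  \int[mu]_(x in D) (k x * \int[leb]_(s in `]0%R, phi x[) w s).
  rewrite -nuET; apply: eq_integral => x _.
  rewrite /G /= ge0_integralZl//; last 2 first.
  - apply: emeasurable_funM => //; apply/measurable_EFinP.
    exact: (measurableT_comp mi (pair1_measurable x)).
  - by move=> y _; rewrite mule_ge0.
  rewrite /k' !patchE; case: ifPn => [xD|]; last by rewrite mul0e.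
  congr (_ * _); rewrite [RHS]integral_mkcond; apply: eq_integral => s _.
  rewrite /i /phi' /patch xD mem_setE in_itv/=.
  by case: ifPn => _; rewrite ?mule1 ?mule0.
have -> : \int[leb]_y \int[nu]_x G (x, y) = \int[leb]_(s in `]0%R, +oo[)
    (w s * \int[mu]_(x in D `&` [set x | (s < phi x)%R]) k x).
  rewrite [RHS]integral_mkcond; apply: eq_integral => s _.
  rewrite {1}/patch mem_setE in_itv/= andbT; case: ifPn => s0; last first.
    by apply: integral0_eq => x _; rewrite /G /i/= (negbTE s0) /= !mule0.
  rewrite integral_mkcondr -nuET -ge0_integralZl//; last 2 first.
  - rewrite -patch_setI.
    have mE := measurable_superlevel s mD mphi;
      apply/(measurable_restrictT _ mE).
    by apply: measurable_funS mk => // x [].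
  - move=> x _; rewrite /patch; case: ifPn => // /[!inE] Dx.
    by case: ifPn => // _; exact: k0.
  apply: eq_integral => x _; rewrite /G /i /k' /phi' /patch s0 /=.
  case: ifPn => xD; last by rewrite !(mul0e,mule0).
  case: ifPn => [|]; first by rewrite inE/= => ->; rewrite mule1 muleC.
  by rewrite notin_setE/= => /negP/negbTE ->; rewrite !mule0.
by [].
Qed.

Lemma layer_cake1 (k : T -> \bar R) (phi : T -> R) :
  measurable_fun D k -> (forall x, D x -> 0 <= k x) ->
  measurable_fun D phi -> (forall x, D x -> (0 <= phi x)%R) ->
  \int[mu]_(x in D) (k x * (phi x)%:E) =
  \int[leb]_(s in `]0%R, +oo[)
    \int[mu]_(x in D `&` [set x | (s < phi x)%R]) k x.
Proof.
move=> mk k0 mphi phi0.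
transitivity (\int[mu]_(x in D) (k x * \int[leb]_(s in `]0%R, phi x[) 1)).
  apply: eq_integral => x /[!inE] Dx; congr (_ * _).
  rewrite integral_cst//= mul1e lebesgue_measure_itv/= lte_fin.
  have := phi0 _ Dx; rewrite le_eqVlt => /predU1P[<-|->]; first by rewrite ltxx.
  by rewrite oppr0 adde0.
rewrite (@layer_cake k (cst 1))//; apply: eq_integral => s _.
by rewrite mul1e.
Qed.

(** Two applications of the layer cake formula express the integral of a
    product through the measures of intersections of superlevel sets, the only
    data that a rearrangement allows one to compare. *)
Lemma layer_cake2 (phi psi : T -> R) :
  measurable_fun D phi -> (forall x, D x -> (0 <= phi x)%R) ->
  measurable_fun D psi -> (forall x, D x -> (0 <= psi x)%R) ->
  \int[mu]_(x in D) (phi x * psi x)%:E =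
  \int[leb]_(s in `]0%R, +oo[) \int[leb]_(u in `]0%R, +oo[)
     mu (D `&` [set x | (s < psi x)%R] `&` [set x | (u < phi x)%R]).
Proof.
move=> mphi phi0 mpsi psi0.
under eq_integral do rewrite EFinM.
rewrite (@layer_cake1 (EFin \o phi))//; last exact/measurable_EFinP.
apply: eq_integral => s _.
have mE := measurable_superlevel s mD mpsi.
transitivity (\int[mu]_(x in D)
    ((\1_[set x | (s < psi x)%R] x)%:E * (phi x)%:E)).
  rewrite integral_mkcondr; apply: eq_integral => x xD.
  by rewrite /patch indicE/=; case: ifPn; rewrite ?mul1e ?mul0e.
have mI : measurable_fun D (EFin \o \1_[set x | (s < psi x)%R] : T -> \bar R).
  apply/measurable_EFinP.
  apply: (eq_measurable_fun (\1_(D `&` [set x | (s < psi x)%R]) : T -> R)).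
    by move=> x xD; rewrite !indicE in_setI xD.
  exact: measurable_indic.
rewrite (@layer_cake1 (EFin \o \1_[set x | (s < psi x)%R]))//; last first.
  by move=> x _ /=; rewrite lee_fin indicE.
apply: eq_integral => u _.
have mE' := measurable_superlevel u mD mphi.
rewrite (_ : D `&` _ `&` _ = (D `&` [set x | (s < psi x)%R]) `&`
   (D `&` [set x | (u < phi x)%R])); last by rewrite setIACA setIid setIA.
rewrite -(integral_indic mu mE' mE); apply: eq_integral => x.
by rewrite inE/= => -[Dx _]; rewrite !indicE in_setI (mem_set Dx).
Qed.
End layer_cake.

(** * The decreasing rearrangement *)

(** The open rays to the right form a pi-system that generates the Borel sets,
    so two finite image measures that agree on them are equal. *)
Lemma equimeasurable_preimage d1 d2 (T1 : measurableType d1)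
    (T2 : measurableType d2) (R : realType)
    (mu : {measure set T1 -> \bar R}) (nu : {measure set T2 -> \bar R})
    (D : set T1) (E : set T2) (phi : T1 -> R) (psi : T2 -> R) (c : R) :
  measurable D -> mu D < +oo -> measurable E -> nu E < +oo -> (0 <= c)%R ->
  measurable_fun D phi -> measurable_fun E psi ->
  (forall s : R, mu (D `&` [set x | (s < phi x)%R]) =
             c%:E * nu (E `&` [set x | (s < psi x)%R])) ->
  forall A, measurable A ->
    mu (D `&` phi @^-1` A) = c%:E * nu (E `&` psi @^-1` A).
Proof.
move=> mD Dfin mE Efin c0 mphi mpsi H A mA.
have mphi' := (measurable_restrictT phi mD).1 mphi.
have mpsi' := (measurable_restrictT psi mE).1 mpsi.
pose mu' : {measure set T1 -> \bar R} := mfrestr mD Dfin.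
pose nu' : {measure set T2 -> \bar R} := mfrestr mE Efin.
pose m1 := measure_function_pushforward__canonical__measure_function_Measure
  mu' mphi'.
pose m2' := measure_function_pushforward__canonical__measure_function_Measure
  nu' mpsi'.
pose m2 := mscale (NngNum c0) m2'.
have m1E B : m1 B = mu (D `&` phi @^-1` B).
  rewrite /m1 /pushforward/= /mfrestr /mrestr; congr (mu _).
  apply/seteqP; split => x /=; rewrite /patch.
    by move=> [+ Dx]; rewrite mem_set.
  by move=> [Dx]; rewrite mem_set.
have m2E B : m2 B = c%:E * nu (E `&` psi @^-1` B).
  rewrite /m2 /mscale /m2' /pushforward/= /mfrestr /mrestr; congr (_ * nu _).
  apply/seteqP; split => x /=; rewrite /patch.
    by move=> [+ Dx]; rewrite mem_set.
  by move=> [Dx]; rewrite mem_set.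
rewrite -m1E -m2E.
apply: (measure_unique (@RGenOInfty.G R) (fun k =>
  `](- k%:R)%R, +oo[%classic)) => //.
- exact: RGenOInfty.measurableE.
- move=> _ _ [x ->] [y ->]; exists (Num.max x y).
  apply/seteqP; split => z /=; rewrite !in_itv/= !andbT gt_max.
    by move=> [-> ->].
  by move=> /andP[].
- by move=> k; exists (- k%:R)%R.
- apply/seteqP; split => // x _; exists (Num.truncn `|x|).+1 => //=.
  rewrite in_itv/= andbT ltrNl.
  by rewrite (le_lt_trans _ (truncnS_gt _))// -normrN ler_norm.
- move=> _ [x ->]; apply: etrans (m1E _) _; apply: etrans _ (esym (m2E _)).
  have := H x; congr (mu (_ `&` _) = _ * nu (_ `&` _));
    by apply/seteqP; split => z/=; rewrite in_itv/= andbT.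
- move=> k; rewrite m1E (le_lt_trans _ Dfin)//; apply: le_measure;
  rewrite ?inE//.
  exact: mphi.
Qed.

Lemma nonincreasing_itv_measurable (R : realType) (I : interval R) (F :
  R -> R) :
  (forall x y, x \in I -> y \in I -> (x <= y)%R -> (F y <= F x)%R) ->
  measurable_fun [set` I] F.
Proof.
move=> ndF; apply: (measurability (@RGenOInfty.G R)) => [|/= _ [_] [r] -> <-].
  exact: RGenOInfty.measurableE.
apply: is_interval_measurable => s t [sI Fs] [tI Ft] u sut.
have uI := interval_is_interval sI tI sut.
split; first exact: uI.
move: Ft; rewrite /= !in_itv/= !andbT => /lt_le_trans; apply.
by apply: ndF => //; case/andP: sut.
Qed.

Section rearrangement.
Context d (T : measurableType d) (R : realType).
Variables (mu : {measure set T -> \bar R}) (D : set T).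
Hypotheses (mD : measurable D) (Dfin : mu D < +oo).
Local Notation leb := (@lebesgue_measure R).
Implicit Types (f : T -> R) (s t : R).

Let m := fine (mu D).
Let mE : mu D = m%:E. Proof. by rewrite /m fineK// ge0_fin_numE. Qed.
Let m0 : (0 <= m)%R. Proof. by rewrite -lee_fin -mE. Qed.

Let mabs f : measurable_fun D f -> measurable_fun D (fun x => `|f x|%R).
Proof. by move=> mf; exact: measurableT_comp. Qed.

(** When finite, the infimum defining the rearrangement is attained, because the
    distribution function of |f| is right continuous: the superlevel set at s is
    the increasing union of the superlevel sets at s + 1/(n+1). *)
Lemma rearrangement_leP f s (t : \bar R) : measurable_fun D f -> (0 <= s)%R ->
  rearrangement mu D f t <= s%:E <-> mu (D `&` [set x | (s < `|f x|)%R]) <= t.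
Proof.
move=> /mabs mf s0; split; last first.
  by move=> H; apply: ereal_inf_lbound; exists s.
move=> H.
pose F n := D `&` [set x | (s + n.+1%:R^-1 < `|f x|)%R].
have mF n : measurable (F n) by exact: measurable_superlevel.
have FE : \bigcup_n F n = D `&` [set x | (s < `|f x|)%R].
  apply/seteqP; split => x /=.
    move=> [n _ [Dx /=]] sf; split => //; apply: le_lt_trans sf.
    by rewrite lerDl invr_ge0.
  move=> [Dx]; rewrite -subr_gt0 => sf.
  have := near_infty_natSinv_lt (PosNum sf) => -[n _ /(_ n (leqnn n)) /=].
  by rewrite ltrBrDl => sfn; exists n.
have mFE : measurable (\bigcup_n F n) by exact: bigcup_measurable.
have ndF : nondecreasing_seq F.
  move=> a b ab; apply/subsetPset => x [Dx /= h]; split => //=.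
  by apply: le_lt_trans h; rewrite lerD2l lef_pV2 ?posrE// ler_nat.
have cF := nondecreasing_cvg_mu (mu := mu) mF mFE ndF.
rewrite -FE -(cvg_lim _ cF)//; apply: lime_le; first by apply/cvg_ex; eexists;
  exact: cF.
apply: nearW => n.
have : rearrangement mu D f t < (s + n.+1%:R^-1)%:E.
  by rewrite (le_lt_trans H)// lte_fin ltrDl invr_gt0.
move=> /ereal_inf_lt[_ [r [r0 Hr] <-]]; rewrite lte_fin => rs /=.
apply: le_trans Hr; apply: le_measure; rewrite ?inE//.
  exact: measurable_superlevel.
by move=> x [Dx /=] h; split => //=; exact: lt_trans h.
Qed.

Lemma rearrangement_ge0 f (t : \bar R) : 0 <= rearrangement mu D f t.
Proof. by apply: le_ereal_inf_tmp => _ [s [s0 _] <-]; rewrite lee_fin. Qed.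

(** As [mu D] is finite, the superlevel sets {|f| > n} decrease to the empty set
    in measure, so some n belongs to the set whose infimum is taken, unless
    [mu D] = 0, when 0 does. *)
Lemma rearrangement_fin_num f t : measurable_fun D f -> (0 < t)%R ->
  rearrangement mu D f (t%:E * mu D) \is a fin_num.
Proof.
move=> mf t0; rewrite ge0_fin_numE ?rearrangement_ge0//.
suff [s s0 H] : exists2 s, (0 <= s)%R &
    mu (D `&` [set x | (s < `|f x|)%R]) <= t%:E * mu D.
  by rewrite (@le_lt_trans _ _ s%:E) ?ltry//; apply/rearrangement_leP.
have [m00|mn0] := eqVneq m 0%R.
  have muD0 : mu D = 0 by rewrite mE m00.
  exists 0%R => //; rewrite muD0 mule0 -muD0.
  by apply: le_measure; rewrite ?inE//; apply: measurable_superlevel => //;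
    exact: mabs.
have mgt0 : (0 < m)%R by rewrite lt_neqAle eq_sym mn0.
pose F n := D `&` [set x | (n%:R < `|f x|)%R].
have mF n : measurable (F n) by apply: measurable_superlevel => //; exact: mabs.
have F0 : \bigcap_n F n = set0.
  rewrite -subset0 => x /= H; have [_ /=] := H (Num.truncn `|f x|).+1 I.
  by apply/negP; rewrite -leNgt ltW// truncnS_gt.
have mF0 : measurable (\bigcap_n F n) by rewrite F0.
have niF : nonincreasing_seq F.
  move=> a b ab; apply/subsetPset => x [Dx /= h]; split => //=.
  by apply: le_lt_trans h; rewrite ler_nat.
have Ffin : mu (F 0%N) < +oo.
  rewrite (le_lt_trans _ Dfin)//; apply: le_measure; rewrite ?inE//.
  by move=> x [].
have := nonincreasing_cvg_mu Ffin mF mF0 niF; rewrite F0 measure0 => cF.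
have tm0 : 0 < t%:E * mu D by rewrite mE -EFinM lte_fin mulr_gt0.
have [n Hn] : exists n, mu (F n) < t%:E * mu D.
  apply: contrapT => /forallNP H; move: tm0; apply/negP; rewrite -leNgt.
  rewrite -(cvg_lim _ cF)//; apply: lime_ge; first by apply/cvg_ex; exists 0.
  by apply: nearW => n; rewrite leNgt; apply/negP; exact: H.
by exists n%:R => //; exact: ltW.
Qed.

(** The argument is normalized, so that all rearrangements live on (0,1) whatever
    the value of [mu D]. *)
Definition drearr f t : R := fine (rearrangement mu D f (t%:E * mu D)).

Lemma drearrE f t : measurable_fun D f -> (0 < t)%R ->
  rearrangement mu D f (t%:E * mu D) = (drearr f t)%:E.
Proof. by move=> mf t0; rewrite /drearr fineK// rearrangement_fin_num. Qed.

Lemma drearr_ge0 f t : (0 <= drearr f t)%R.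
Proof. exact/fine_ge0/rearrangement_ge0. Qed.

Lemma drearr_le f s t : measurable_fun D f -> (0 <= s)%R -> (0 < t)%R ->
  (drearr f t <= s)%R <->
  mu (D `&` [set x | (s < `|f x|)%R]) <= t%:E * mu D.
Proof.
by move=> mf s0 t0; rewrite -lee_fin -drearrE//; exact: rearrangement_leP.
Qed.

Lemma drearr_nincr f t u : measurable_fun D f -> (0 < t)%R -> (t <= u)%R ->
  (drearr f u <= drearr f t)%R.
Proof.
move=> mf t0 tu; have u0 := lt_le_trans t0 tu.
apply/drearr_le => //; first exact: drearr_ge0.
apply: (@le_trans _ _ (t%:E * mu D)); last by rewrite lee_wpmul2r.
by apply/drearr_le => //; exact: drearr_ge0.
Qed.

Lemma measurable_drearr f : measurable_fun D f ->
  measurable_fun (`]0%R, 1%R[%classic : set R) (drearr f).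
Proof.
move=> mf; apply: nonincreasing_itv_measurable => x y.
by rewrite !in_itv/= => /andP[x0 _] _ xy; exact: drearr_nincr.
Qed.

(** By [drearr_le], the points t of (0,1) with f#(t) > s are those with
    t [mu D] < mu {|f| > s}; they form an interval starting at 0. *)
Lemma superlevel_drearr f s : measurable_fun D f ->
  mu (D `&` [set x | (s < `|f x|)%R]) =
  m%:E * leb (`]0%R, 1%R[ `&` [set t | (s < drearr f t)%R]).
Proof.
move=> mf.
have [s0|s0] := leP 0%R s; last first.
  rewrite (_ : D `&` _ = D).
    rewrite (_ : _ `&` _ = `]0%R, 1%R[%classic).
      by rewrite lebesgue_measure_itv/= lte01 oppr0 adde0 mule1 mE.
    apply/seteqP; split => [x []//|x x01]; split => //=.
    by rewrite (lt_le_trans s0)// drearr_ge0.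
  by apply/seteqP; split => [x []//|x Dx]; split => //=;
    rewrite (lt_le_trans s0).
have mS := measurable_superlevel s mD (mabs mf).
have Sfin : mu (D `&` [set x | (s < `|f x|)%R]) \is a fin_num.
  rewrite ge0_fin_numE// (le_lt_trans _ Dfin)//.
  by apply: le_measure; rewrite ?inE// => x [].
pose l := fine (mu (D `&` [set x | (s < `|f x|)%R])).
have lE : mu (D `&` [set x | (s < `|f x|)%R]) = l%:E by rewrite fineK.
have lm : (l <= m)%R.
  by rewrite -lee_fin -lE -mE; apply: le_measure; rewrite ?inE// => x [].
have l0 : (0 <= l)%R by rewrite -lee_fin -lE.
have ltE t : (0 < t)%R -> (s < drearr f t)%R = (t * m < l)%R.
  move=> t0; rewrite !ltNge; congr (~~ _).
  have := drearr_le mf s0 t0; rewrite lE mE -EFinM lee_fin => H.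
  by apply/idP/idP => /H.
have [m00|mn0] := eqVneq m 0%R.
  by rewrite m00 mul0e lE; congr (_%:E); apply/eqP; rewrite eq_le l0 -m00 lm.
have mgt0 : (0 < m)%R by rewrite lt_neqAle eq_sym mn0.
rewrite (_ : _ `&` _ = `]0%R, (l / m)%R[%classic).
  rewrite lebesgue_measure_itv/= lte_fin lE.
  have := l0; rewrite le_eqVlt => /predU1P[<-|lgt0].
    by rewrite mul0r ltxx mule0.
  rewrite divr_gt0// oppr0 adde0 -EFinM; congr (_%:E).
  by rewrite mulrCA divff// mulr1.
apply/seteqP; split => t /=; rewrite !in_itv/=.
  by move=> [/andP[t0 _]]; rewrite ltE// ltr_pdivlMr// t0.
move=> /andP[t0 tlm]; split; last by rewrite ltE// -ltr_pdivlMr.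
rewrite t0 (lt_le_trans tlm)//.
by rewrite ler_pdivrMr// mul1r.
Qed.

Lemma drearr_preimage f A : measurable_fun D f -> measurable A ->
  mu (D `&` (fun x => `|f x|%R) @^-1` A) =
  m%:E * leb (`]0%R, 1%R[ `&` drearr f @^-1` A).
Proof.
move=> mf mA; apply: equimeasurable_preimage => //.
- by rewrite /= lebesgue_measure_itv/= lte01 oppr0 adde0 ltry.
- exact: mabs.
- exact: measurable_drearr.
- by move=> s; exact: superlevel_drearr.
Qed.
End rearrangement.

(** * The inequalities of Hardy-Littlewood and Hoelder *)

(** Both integrals are suprema over the simple functions below the integrand; in
    this form the comparison applies to the inner integrals of iterated ones. *)
Lemma le_integral_ge0 d (T : measurableType d) (R : realType)
    (mu : {measure set T -> \bar R}) (D : set T) (f g : T -> \bar R) :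
  (forall x, D x -> 0 <= f x) -> (forall x, D x -> f x <= g x) ->
  \int[mu]_(x in D) f x <= \int[mu]_(x in D) g x.
Proof.
move=> f0 fg; have g0 x : D x -> 0 <= g x by move=> Dx;
  exact: le_trans (f0 _ Dx) (fg _ Dx).
rewrite !ge0_integralE//; apply: ge_ereal_sup => _ [h /= hf <-].
apply: ereal_sup_ubound; exists h => //= x.
apply: (le_trans (hf x)); rewrite /patch; case: ifPn => // /[!inE]; exact: fg.
Qed.

Lemma le_integral_superlevel d1 d2 (T1 : measurableType d1)
    (T2 : measurableType d2) (R : realType)
    (mu : {measure set T1 -> \bar R}) (nu : {measure set T2 -> \bar R})
    (D : set T1) (E : set T2) (f g : T1 -> R) (F G : T2 -> R) :
  measurable D -> mu D < +oo -> measurable E -> nu E < +oo ->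
  measurable_fun D f -> (forall x, D x -> (0 <= f x)%R) ->
  measurable_fun D g -> (forall x, D x -> (0 <= g x)%R) ->
  measurable_fun E F -> (forall x, E x -> (0 <= F x)%R) ->
  measurable_fun E G -> (forall x, E x -> (0 <= G x)%R) ->
  (forall s u : R,
    mu (D `&` [set x | (s < g x)%R] `&` [set x | (u < f x)%R]) <=
    nu (E `&` [set x | (s < G x)%R] `&` [set x | (u < F x)%R])) ->
  \int[mu]_(x in D) (f x * g x)%:E <= \int[nu]_(x in E) (F x * G x)%:E.
Proof.
move=> mD Dfin mE Efin mf f0 mg g0 mF F0 mG G0 H.
rewrite (layer_cake2 mD Dfin mf f0 mg g0) (layer_cake2 mE Efin mF F0 mG G0).
apply: le_integral_ge0 => s _; first exact: integral_ge0.
by apply: le_integral_ge0 => u _.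
Qed.

Lemma hoelder_setD d (T : measurableType d) (R : realType)
    (mu : {measure set T -> \bar R}) (D : set T) (f g : T -> R) (p q : R) :
  measurable D -> measurable_fun D f -> measurable_fun D g ->
  (forall x, D x -> (0 <= f x)%R) -> (forall x, D x -> (0 <= g x)%R) ->
  (0 < p)%R -> (0 < q)%R -> (p^-1 + q^-1 = 1)%R ->
  \int[mu]_(x in D) (f x * g x)%:E <=
  (\int[mu]_(x in D) (f x `^ p)%:E) `^ p^-1 *
  (\int[mu]_(x in D) (g x `^ q)%:E) `^ q^-1.
Proof.
move=> mD mf mg f0 g0 p0 q0 pq.
have := hoelder mu ((measurable_restrictT f mD).1 mf)
  ((measurable_restrictT g mD).1 mg) p0 q0 pq.
rewrite Lnorm1 unlock /Lnorm.
have aux r (h : T -> R) : (0 < r)%R -> (forall x, D x -> (0 <= h x)%R) ->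
    \int[mu]_x (`|(EFin \o (h \_ D)) x| `^ r) = \int[mu]_(x in D) (h x `^ r)%:E.
  move=> r0 h0; rewrite [RHS]integral_mkcond; apply: eq_integral => x _.
  rewrite /patch /=; case: ifPn => [/[!inE] Dx|_]; rewrite -poweR_EFin.
    by rewrite /=  ger0_norm// h0.
  change (`|0%R : R|%:E `^ r = 0).
  by rewrite normr0 poweR0r// gt_eqF.
rewrite !aux//; apply: le_trans.
rewrite [leLHS]integral_mkcond; apply: le_integral_ge0 => x _.
  by rewrite /patch; case: ifPn => // /[!inE] Dx;
    rewrite lee_fin mulr_ge0 ?f0 ?g0.
rewrite /= /patch; case: ifPn => _; first by rewrite lee_fin ler_norm.
by apply: (@le_trans _ _ 0); [exact: lexx|rewrite lee_fin].
Qed.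

Section hardy_littlewood.
Context d (T : measurableType d) (R : realType).
Variables (mu : {measure set T -> \bar R}) (D : set T).
Hypotheses (mD : measurable D) (Dfin : mu D < +oo).
Local Notation leb := (@lebesgue_measure R).
Local Notation I01 := (`]0%R, 1%R[%classic : set R).
Local Notation "f ^#" := (drearr mu D f) (at level 2, format "f ^#").
Implicit Types (f g : T -> R) (a q s t : R).

Let m := fine (mu D).
Let mE : mu D = m%:E. Proof. by rewrite /m fineK// ge0_fin_numE. Qed.
Let m0 : (0 <= m)%R. Proof. by rewrite -lee_fin -mE. Qed.

Lemma leb_I01 : leb I01 = 1.
Proof. by rewrite /= lebesgue_measure_itv/= lte01 oppr0 adde0. Qed.

Let mI01 : measurable I01. Proof. exact: measurable_itv. Qed.


Let mfin : mscale (NngNum m0) leb I01 < +oo.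
Proof. by rewrite /mscale /= leb_I01 mule1 ltry. Qed.

(** In the layer cake formula, the measure of {|f| > u} inside {|g| > s} is at
    most the smaller of the two measures, and this is exactly what happens for
    f# and g#, whose superlevel sets are nested intervals. *)
Lemma hardy_littlewood f g : measurable_fun D f -> measurable_fun D g ->
  \int[mu]_(x in D) `|f x * g x|%:E <=
  mu D * \int[leb]_(t in I01) (f^# t * g^# t)%:E.
Proof.
move=> mf mg.
have mfs := measurable_drearr mD Dfin mf.
have mgs := measurable_drearr mD Dfin mg.
rewrite mE -(ge0_integral_mscale leb mI01 (NngNum m0))//; last 2 first.
- by apply/measurable_EFinP; exact: measurable_funM.
- by move=> t _; rewrite lee_fin mulr_ge0// drearr_ge0.
under eq_integral do rewrite normrM.
apply: (@le_integral_superlevel _ _ _ _ R mu (mscale (NngNum m0) leb)) => //.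
- exact: measurableT_comp.
- exact: measurableT_comp.
- by move=> t _; exact: drearr_ge0.
- by move=> t _; exact: drearr_ge0.
move=> s u; rewrite /mscale /=.
have mS (h : T -> R) (r : R) : measurable_fun D h ->
  measurable (D `&` [set x | (r < `|h x|)%R]).
  by move=> mh; apply: measurable_superlevel => //; exact: measurableT_comp.
have mSs (h : T -> R) (r : R) : measurable_fun D h ->
  measurable (I01 `&` [set x | (r < h^# x)%R]).
  by move=> mh; apply: measurable_superlevel => //; exact: measurable_drearr.
have eqI (U : Type) (X Y Z : set U) : X `&` Y `&` Z = (X `&` Y) `&` (X `&` Z).
  by rewrite setIACA setIid setIA.
have nested : (I01 `&` [set t | (s < g^# t)%R]) `<=` [set t | (u < f^# t)%R] \/
              (I01 `&` [set t | (u < f^# t)%R]) `<=` [set t | (s < g^# t)%R].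
  have [|/existsNP[x /not_implyP[[/= + sx] nux]]] :=
    pselect ((I01 `&` [set t | (s < g^# t)%R]) `<=` [set t | (u < f^# t)%R]).
    by left.
  rewrite in_itv/= => /andP[x0 _]; right => y [/=];
    rewrite in_itv/= => /andP[y0 _] uy.
  apply: (lt_le_trans sx); apply: drearr_nincr => //.
  rewrite leNgt; apply/negP => xy; apply: nux.
  by apply: (lt_le_trans uy); apply: drearr_nincr => //; exact: ltW.
case: nested => /setIidl nested.
  rewrite nested; apply: le_trans (_ : mu (D `&` [set x | (s < `|g x|)%R]) <=
    _).
    by apply: le_measure; rewrite ?inE//; [rewrite eqI; apply: measurableI;
      exact: mS|exact: mS].
  by rewrite (superlevel_drearr mD Dfin s mg).
rewrite [in leRHS]setIAC nested; apply: le_trans (_ :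
  mu (D `&` [set x | (u < `|f x|)%R]) <= _).
  apply: le_measure; rewrite ?inE//; [rewrite eqI; apply: measurableI;
    exact: mS|exact: mS|].
  by move=> ? [[]].
by rewrite (superlevel_drearr mD Dfin u mf).
Qed.

Lemma lorentz_integralE a q f : measurable_fun D f -> (0 < q)%R ->
  lorentz_integral mu D a q%:E f =
  (\int[leb]_(t in I01) (t `^ (a * q - 1) * f^# t `^ q)%:E) `^ q^-1.
Proof.
move=> mf q0; rewrite /lorentz_integral; congr (_ `^ _).
apply: eq_integral => t; rewrite inE/= in_itv/= => /andP[t0 t1].
rewrite drearrE// -(EFinM (t `^ a)) poweR_EFin -EFinM; congr (_%:E).
rewrite powRM ?powR_ge0 ?drearr_ge0// -powRrM powRB ?(gt_eqF t0) ?implybT//.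
by rewrite powRr1 ?ltW// mulrAC.
Qed.

Lemma lorentz_integral_inftyE a f : measurable_fun D f ->
  lorentz_integral mu D a +oo f =
  ereal_sup [set (t `^ a * f^# t)%:E | t in I01].
Proof.
move=> mf; rewrite /lorentz_integral; congr ereal_sup.
by apply: eq_imagel => t /=; rewrite in_itv/= => /andP[t0 t1]; rewrite drearrE.
Qed.

Lemma lorentz_integral_ge0 a (q : \bar R) f : measurable_fun D f ->
  0 <= lorentz_integral mu D a q f.
Proof.
move=> mf; rewrite /lorentz_integral.
have aux : 0 <= ereal_sup [set (t `^ a)%:E * rearrangement mu D f (t%:E * mu D)
    | t in `]0%R, 1%R[].
  apply: le_ereal_sup_tmp; exists ((2^-1 `^ a)%:E * rearrangement mu D f
    (2^-1%:E * mu D)).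
    by exists 2^-1%R => //=; rewrite in_itv/= invr_gt0 ltr0n invf_lt1// ltr1n.
  by rewrite mule_ge0 ?lee_fin ?powR_ge0 ?rearrangement_ge0.
by case: q => // r; exact: poweR_ge0.
Qed.

(** Hoelder's inequality for dt/t, applied to t^a f# and t^(1-a) g#; for
    q = 1 one of the two norms is a supremum. *)
Lemma hoelder_lorentz a q f g :
  measurable_fun D f -> measurable_fun D g -> (1 <= q)%R ->
  \int[leb]_(t in I01) (f^# t * g^# t)%:E <=
  lorentz_integral mu D a q%:E f *
  lorentz_integral mu D (1 - a) (hoelder_conjugate q%:E) g.
Proof.
move=> mf mg q1.
have mfs := measurable_drearr mD Dfin mf.
have mgs := measurable_drearr mD Dfin mg.
have mpow b : measurable_fun I01 (fun t : R => t `^ b)%R.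
  by apply: measurable_funTS; exact: measurable_powR.
have q0 : (0 < q)%R by exact: lt_le_trans q1.
move: q1; rewrite le_eqVlt => /predU1P[q1|q1].
  rewrite -q1 hoelder_conjugate1 lorentz_integral_inftyE//.
  set S := ereal_sup _.
  have S0 : 0 <= S by rewrite /S -lorentz_integral_inftyE//
    lorentz_integral_ge0.
  rewrite lorentz_integralE// invr1 poweRe1; last first.
    by apply: integral_ge0 => t _; rewrite lee_fin mulr_ge0 ?powR_ge0.
  rewrite -ge0_integralZr//; last 2 first.
  - apply/measurable_EFinP; apply: measurable_funM; first exact: mpow.
    apply: (eq_measurable_fun f^#) => //.
    by move=> t _; rewrite powRr1// drearr_ge0.
  - by move=> t _; rewrite lee_fin mulr_ge0 ?powR_ge0.
  apply: le_integral_ge0 => t; first by rewrite lee_fin mulr_ge0 ?drearr_ge0.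
  rewrite /= in_itv/= => /andP[t0 t1].
  rewrite mulr1 powRr1 ?drearr_ge0//.
  apply: (@le_trans _ _ ((t `^ (a - 1) * f^# t)%:E * (t `^ (1 - a) * g^#
    t)%:E)).
    rewrite -EFinM lee_fin mulrACA -powRD ?(gt_eqF t0) ?implybT//.
    by rewrite subrKA subrr powRr0 mul1r.
  apply: lee_wpmul2l; first by rewrite lee_fin mulr_ge0 ?powR_ge0 ?drearr_ge0.
  by apply: ereal_sup_ubound; exists t => //=; rewrite in_itv/= t0.
have q10 : (0 < q - 1)%R by rewrite subr_gt0.
have -> : hoelder_conjugate q%:E = (q / (q - 1))%:E.
  by rewrite /hoelder_conjugate/= eqe gt_eqF// -EFinD inver gt_eqF.
set q' := (q / (q - 1))%R.
have q'0 : (0 < q')%R by rewrite divr_gt0.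
have qq' : (q^-1 + q'^-1 = 1)%R by rewrite /q'; field; rewrite !gt_eqF.
rewrite !lorentz_integralE//.
pose F t := (t `^ (a - q^-1) * f^# t)%R.
pose G t := (t `^ (1 - a - q'^-1) * g^# t)%R.
have := @hoelder_setD _ _ R leb I01 F G q q' mI01.
rewrite (_ : \int[leb]_(x in I01) (F x * G x)%:E =
  \int[leb]_(t in I01) (f^# t * g^# t)%:E); last first.
  apply: eq_integral => t; rewrite inE/= in_itv/= => /andP[t0 t1].
  rewrite /F /G mulrACA -powRD ?(gt_eqF t0) ?implybT//.
  rewrite (_ : (_ + _)%R = 0%R) ?powRr0 ?mul1r//.
  by rewrite addrACA -opprD qq'; ring.
rewrite (_ : \int[leb]_(x in I01) (F x `^ q)%:E =
  \int[leb]_(t in I01) (t `^ (a * q - 1) * f^# t `^ q)%:E); last first.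
  apply: eq_integral => t; rewrite inE/= in_itv/= => /andP[t0 t1].
  rewrite /F powRM ?powR_ge0 ?drearr_ge0// -powRrM mulrBl mulVf ?gt_eqF//.
rewrite (_ : \int[leb]_(x in I01) (G x `^ q')%:E =
  \int[leb]_(t in I01) (t `^ ((1 - a) * q' - 1) * g^# t `^ q')%:E); last first.
  apply: eq_integral => t; rewrite inE/= in_itv/= => /andP[t0 t1].
  rewrite /G powRM ?powR_ge0 ?drearr_ge0// -powRrM mulrBl mulVf ?gt_eqF//.
apply => //.
- by apply: measurable_funM => //; exact: mpow.
- by apply: measurable_funM => //; exact: mpow.
- by move=> t _; rewrite mulr_ge0 ?powR_ge0 ?drearr_ge0.
- by move=> t _; rewrite mulr_ge0 ?powR_ge0 ?drearr_ge0.
Qed.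

End hardy_littlewood.

(** * Integrals of powers *)

Lemma le0_ler_powR (R : realType) (r x y : R) :
  (r <= 0)%R -> (0 < x)%R -> (x <= y)%R -> (y `^ r <= x `^ r)%R.
Proof.
move=> r0 x0 xy; have y0 := lt_le_trans x0 xy.
rewrite -(opprK r) !(powRN _ (- r)) lef_pV2 ?posrE ?powR_gt0//.
by apply: ge0_ler_powR; rewrite ?oppr_ge0 ?nnegrE// ltW.
Qed.

(** The integrand is singular at 0 when [al] < 1: the fundamental theorem of
    calculus is applied on (b/(n+1), b), and the intervals increase to (0, b). *)
Lemma integral_powR_le (R : realType) (al b : R) : (0 < al)%R ->
  \int[@lebesgue_measure R]_(t in `]0%R, b[) (t `^ (al - 1))%:E <=
  (b `^ al / al)%:E.
Proof.
move=> al0.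
have rhs0 : (0 <= b `^ al / al)%R by rewrite divr_ge0 ?powR_ge0 ?ltW.
have [b0|b0] := leP b 0%R.
  by rewrite set_itv_ge ?integral_set0 ?lee_fin// bnd_simp -leNgt.
pose I n : set R := `](b / n.+1%:R)%R, b[%classic.
have mpow n : measurable_fun (I n) (fun t : R => (t `^ (al - 1))%:E).
  by apply/measurable_EFinP/measurable_funTS; exact: measurable_powR.
have IE : `]0%R, b[%classic = \bigcup_n I n.
  apply/seteqP; split => t /=; last first.
    move=> [n _]; rewrite /I /= !in_itv/= => /andP[nt ->]; rewrite andbT.
    by rewrite (le_lt_trans _ nt)// divr_ge0// ltW.
  rewrite in_itv/= => /andP[t0 tb].
  have := near_infty_natSinv_lt (PosNum (divr_gt0 t0 b0)) =>
    -[n _ /(_ n (leqnn n))/=].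
  by rewrite ltr_pdivlMr// mulrC => tn; exists n => //;
    rewrite /I /= in_itv/= tn.
have ndI : nondecreasing_seq I.
  move=> i j ij; apply/subsetPset => t; rewrite /I /= !in_itv/= => /andP[it ->].
  rewrite andbT (le_lt_trans _ it)// ler_pM2l// lef_pV2 ?posrE// ler_nat.
  exact: ij.
have cI := ge0_nondecreasing_set_cvg_integral (mu := @lebesgue_measure R)
  ndI (fun i => measurable_itv _) mpow (fun _ _ _ => powR_ge0 _ _).
rewrite IE -(cvg_lim _ cI)//; apply: lime_le.
  by apply/cvg_ex; eexists; exact: cI.
apply: nearW => n.
set e := (b / n.+1%:R)%R.
have e0 : (0 < e)%R by rewrite divr_gt0.
have [eb|be] := ltP e b; last first.
  by rewrite /I set_itv_ge ?integral_set0 ?lee_fin// bnd_simp -leNgt.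
pose P (t : R) : R := (t `^ al / al)%R.
have dF (x : R) : (0 < x)%R -> is_derive x 1%R P (x `^ (al - 1))%R.
  move=> x0.
  have x0' : x \in `]0%R, +oo[ by rewrite in_itv/= x0.
  have H1 : derivable (@powR R ^~ al) x 1 by exact: derivable_powR.
  have H2 := powR_derive1 al x0'.
  rewrite derive1E in H2.
  have : is_derive x 1%R (@powR R ^~ al) (al * x `^ (al - 1))%R by apply:
    DeriveDef.
  move=> H.
  have -> : P = (al^-1 \*: (@powR R ^~ al))%R.
    by apply/funext => t /=; rewrite /GRing.scale/= mulrC.
  apply: is_derive_eq; rewrite /GRing.scale/= mulrA mulVf ?mul1r// gt_eqF//.
have cF (x : R) : (0 < x)%R -> {for x, continuous P}.
  move=> x0; apply/differentiable_continuous/derivable1_diffP.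
  by have [] := dF x x0.
rewrite /I -(@integral_itv_bndoo _ _ _ _ true false); last exact: mpow.
rewrite (@continuous_FTC2 _ _ P)//.
- by rewrite leeBlDr// leeDl// lee_fin divr_ge0 ?powR_ge0 ?ltW.
- apply: continuous_in_subspaceT => x; rewrite inE/= in_itv/= => /andP[ex _].
  have x0 := lt_le_trans e0 ex.
  apply/differentiable_continuous/derivable1_diffP; apply: derivable_powR.
  by rewrite in_itv/= x0.
- split.
  + by move=> x; rewrite in_itv/= => /andP[/(lt_trans e0) /dF []].
  + by apply: cvg_at_right_filter; exact: cF.
  + by apply: cvg_at_left_filter; exact: cF.
- move=> x; rewrite in_itv/= => /andP[/(lt_trans e0) x0 _].
  by rewrite derive1E; have [_ ->] := dF x x0.
Qed.

(** * Plateaus of a decreasing function *)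

Section profile.
Context (R : realType).
Local Notation leb := (@lebesgue_measure R).
Local Notation I01 := (`]0%R, 1%R[%classic : set R).
Variable F : R -> R.
Hypothesis F0 : forall t, (0 <= F t)%R.
Hypothesis Fni : forall t u, (0 < t)%R -> (t <= u)%R -> (F u <= F t)%R.

(** For s = F(t) and F nonincreasing, this is the right end of the interval on
    which F is at least F(t), that is of the plateau of F containing t. *)
Definition plateau_end (s : R) : R := fine (leb (I01 `&` [set u | (s <= F
  u)%R])).
Local Notation tau := plateau_end.

Let leb_mono (A B : set R) : measurable A -> measurable B -> A `<=` B ->
  leb A <= leb B.
Proof. by move=> mA mB AB; apply: le_measure; rewrite ?inE. Qed.

Let mF : measurable_fun I01 F.
Proof.
apply: nonincreasing_itv_measurable => x y.
by rewrite !in_itv/= => /andP[x0 _] _ xy; exact: Fni.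
Qed.

Let mS s : measurable (I01 `&` [set u | (s <= F u)%R]).
Proof.
rewrite (_ : [set u | _] = F @^-1` `[s, +oo[%classic).
  exact: mF.
by apply/seteqP; split => x /=; rewrite in_itv/= andbT.
Qed.

Let lebS (A : set R) : measurable A -> A `<=` I01 -> leb A \is a fin_num.
Proof.
move=> mA AI; rewrite ge0_fin_numE//; apply: (@le_lt_trans _ _ (leb I01)).
  by apply: leb_mono => //; exact: measurable_itv.
by rewrite leb_I01 ltry.
Qed.

Let tauE s : leb (I01 `&` [set u | (s <= F u)%R]) = (tau s)%:E.
Proof. by rewrite /tau fineK// lebS// => x []. Qed.

Lemma plateau_end_ge0 s : (0 <= tau s)%R.
Proof. by rewrite -lee_fin -tauE. Qed.

Lemma plateau_end_le1 s : (tau s <= 1)%R.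
Proof.
by rewrite -lee_fin -tauE -leb_I01; apply: leb_mono => // x [].
Qed.

Lemma plateau_end_nincr s s' : (s <= s')%R -> (tau s' <= tau s)%R.
Proof.
move=> ss; rewrite -lee_fin -!tauE; apply: leb_mono => //.
move=> x [xI /= s'F]; by split => //=; exact: le_trans ss s'F.
Qed.

Lemma measurable_plateau_end : measurable_fun setT tau.
Proof. by apply: nonincreasing_measurable => // x y;
  exact: plateau_end_nincr. Qed.

Lemma le_plateau_end t : (0 < t)%R -> (t < 1)%R -> (t <= tau (F t))%R.
Proof.
move=> t0 t1; rewrite -lee_fin -tauE.
rewrite (_ : t%:E = leb `]0%R, t[%classic); last first.
  by rewrite lebesgue_measure_itv/= lte_fin t0 oppr0 adde0.
apply: leb_mono => //.
move=> u /=; rewrite !in_itv/= => /andP[u0 ut]; split;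
  last by rewrite Fni// ltW.
by rewrite u0 (lt_trans ut).
Qed.

Lemma plateau_end_lt u t : (0 < u)%R -> (u < tau (F t))%R -> (F t <= F u)%R.
Proof.
move=> u0; rewrite leNgt; apply: contraPN => Fut.
apply/negP; rewrite -leNgt -lee_fin -tauE.
rewrite (_ : u%:E = leb `]0%R, u[%classic); last first.
  by rewrite lebesgue_measure_itv/= lte_fin u0 oppr0 adde0.
apply: leb_mono => //.
move=> v /=; rewrite !in_itv/= => -[/andP[v0 v1] Ftv]; rewrite v0 ltNge.
apply/negP => uv; have := le_lt_trans (le_trans Ftv (Fni u0 uv)) Fut.
by rewrite ltxx.
Qed.

(** If [al] >= 1, then t <= tau(F(t)) gives the claim pointwise. If [al] < 1,
    the inequality is checked on each superlevel set {F^q > s} and integrated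
    with the layer cake formula. Such a set is an interval with left end 0; if l
    is its length, tau(F(t)) <= l on it, so the right-hand side is at least
    l^(al-1) l = l^al, while the integral of t^(al-1) is at most l^al/al. *)
Lemma le_integral_plateau_end (c al q : R) :
  (0 < c)%R -> (c <= 1)%R -> (c <= al)%R -> (0 < q)%R ->
  c%:E * \int[leb]_(t in I01) (t `^ (al - 1) * F t `^ q)%:E <=
  \int[leb]_(t in I01) (tau (F t) `^ (al - 1) * F t `^ q)%:E.
Proof.
move=> c0 c1 cal q0; have al0 := lt_le_trans c0 cal.
have mFq : measurable_fun I01 (fun t => F t `^ q)%R.
  by apply: (measurableT_comp (measurable_powR _)).
have mpow b : measurable_fun I01 (fun t : R => t `^ b)%R.
  by apply: measurable_funTS; exact: measurable_powR.
have mtau : measurable_fun I01 (fun t => tau (F t) `^ (al - 1))%R.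
  apply: (measurableT_comp (measurable_powR _)).
  by apply: measurableT_comp; first exact: measurable_plateau_end.
rewrite -ge0_integralZl_EFin//; last 3 first.
- by move=> t _; rewrite lee_fin mulr_ge0 ?powR_ge0.
- by apply/measurable_EFinP/measurable_funM => //; exact: mpow.
- exact: ltW.
have [al1|al1] := leP 1%R al.
  apply: le_integral_ge0 => t It.
    by rewrite mule_ge0 ?lee_fin ?mulr_ge0 ?powR_ge0// ltW.
  move: It; rewrite /= in_itv/= => /andP[t0 t1]; rewrite lee_fin mulrA.
  apply: ler_wpM2r; first exact: powR_ge0.
  apply: (@le_trans _ _ (t `^ (al - 1))%R).
    by rewrite ger_pMl ?powR_gt0.
  apply: ge0_ler_powR; rewrite ?subr_ge0 ?nnegrE ?plateau_end_ge0//;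
    first exact: ltW.
  exact: le_plateau_end.
under eq_integral do rewrite EFinM muleA.
under [leRHS]eq_integral do rewrite EFinM.
have fI : leb I01 < +oo by rewrite leb_I01 ltry.
have mI : measurable I01 by exact: measurable_itv.
rewrite (@layer_cake1 _ _ _ leb I01 mI fI (fun t =>
  c%:E * (t `^ (al - 1))%:E))//; last 3 first.
- by apply/measurable_EFinP; apply: measurable_funM => //; exact: mpow.
- by move=> t _; rewrite mule_ge0 ?lee_fin ?powR_ge0// ltW.
- by move=> t _; exact: powR_ge0.
rewrite (@layer_cake1 _ _ _ leb I01 mI fI (fun t =>
  (tau (F t) `^ (al - 1))%:E))//; last 3 first.
- exact/measurable_EFinP.
- by move=> t _; rewrite lee_fin powR_ge0.
- by move=> t _; exact: powR_ge0.
apply: le_integral_ge0 => s _.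
  by apply: integral_ge0 => t _; rewrite mule_ge0 ?lee_fin ?powR_ge0// ltW.
set E := I01 `&` _.
have mE : measurable E by exact: measurable_superlevel.
have EI : E `<=` I01 by move=> x [].
pose l := fine (leb E).
have lE : leb E = l%:E by rewrite /l fineK// lebS.
have l0 : (0 <= l)%R by rewrite -lee_fin -lE.
have Etau t : E t -> (tau (F t) <= l)%R.
  move=> [It /= sF]; rewrite -lee_fin -lE -tauE; apply: leb_mono => //.
  move=> u [Iu /= Ftu]; split => //=; apply: (lt_le_trans sF).
  by apply: ge0_ler_powR; rewrite ?nnegrE// ltW.
have El t : E t -> (t <= l)%R.
  move=> Et; apply: le_trans (Etau _ Et); apply: le_plateau_end;
  by case: Et; rewrite /= in_itv/= => /andP[].
apply: (@le_trans _ _ (l `^ al)%:E).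
  apply: (@le_trans _ _ (\int[leb]_(t in `]0%R, l]) (c%:E * (t `^ (al -
    1))%:E))).
    apply: ge0_subset_integral => //.
    - by apply/measurable_EFinP/measurable_funM => //;
      apply: measurable_funTS; exact: measurable_powR.
    - by move=> t _; rewrite mule_ge0 ?lee_fin ?powR_ge0// ltW.
    - move=> t Et; rewrite /= in_itv/= El//.
      by case: Et; rewrite /= in_itv/= => /andP[-> _].
  rewrite ge0_integralZl_EFin//; last 3 first.
  - by move=> t _; rewrite lee_fin powR_ge0.
  - by apply/measurable_EFinP; apply: measurable_funTS; exact: measurable_powR.
  - exact: ltW.
  rewrite -integral_itv_bndo_bndc; last first.
    by apply/measurable_EFinP; apply: measurable_funTS; exact: measurable_powR.
  apply: (@le_trans _ _ (c%:E * (l `^ al / al)%:E)).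
    by apply: lee_wpmul2l; [rewrite lee_fin ltW|exact: integral_powR_le].
  rewrite -EFinM lee_fin mulrCA ler_piMr ?powR_ge0//.
  by rewrite ler_pdivrMr// mul1r.
apply: (@le_trans _ _ (\int[leb]_(t in E) (l `^ (al - 1))%:E)).
  have -> : \int[leb]_(t in E) (l `^ (al - 1))%:E = (l `^ (al - 1))%:E * leb E.
    by rewrite integral_cst.
  rewrite lE -EFinM lee_fin mulrC.
  move: l0; rewrite le_eqVlt => /predU1P[<-|l0].
    by rewrite powR0 ?gt_eqF// mul0r.
  by rewrite mulr_powRB1// ltW.
apply: le_integral_ge0 => t Et; first by rewrite lee_fin powR_ge0.
rewrite lee_fin; apply: le0_ler_powR.
- by rewrite subr_le0 ltW.
- have [] := Et; rewrite /= in_itv/= => /andP[t0 t1] _.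
  exact: lt_le_trans (le_plateau_end t0 t1).
- exact: Etau.
Qed.

End profile.

(** * A decreasing extremal function *)

Section dual_profile.
Context (R : realType).
Local Notation leb := (@lebesgue_measure R).
Local Notation I01 := (`]0%R, 1%R[%classic : set R).
Variables (F : R -> R) (a q : R).
Hypothesis F0 : forall t, (0 <= F t)%R.
Hypothesis Fni : forall t u, (0 < t)%R -> (t <= u)%R -> (F u <= F t)%R.
Hypotheses (q1 : (1 < q)%R) (a1 : (a < 1)%R).
Local Notation tau := (plateau_end F).

Let q' := (q / (q - 1))%R.
Let al := (a * q)%R.
Let ga := ((1 - a) * q')%R.
Let A := \int[leb]_(t in I01) (t `^ (al - 1) * F t `^ q)%:E.
Hypothesis Afin : A < +oo.

Let kk (u : R) := (u `^ (al - ga - 1) * F u `^ q)%R.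

Let tail (s : R) := \int[leb]_(u in I01 `&` [set u | (s < 2 * u)%R]) (kk u)%:E.

(** The q'-th root of the tail integral over (s/2, 1). Integrating on
    (s/2, s) makes the profile dominate the extremal function
    of Hoelder's inequality, and integrating up to 1 makes it nonincreasing. *)
Definition dual_profile (s : R) : R := (fine (tail s) `^ q'^-1)%R.

Let q0 : (0 < q)%R. Proof. exact: lt_trans q1. Qed.
Let q10 : (0 < q - 1)%R. Proof. by rewrite subr_gt0. Qed.
Let q'0 : (0 < q')%R. Proof. by rewrite divr_gt0. Qed.
Let ga0 : (0 < ga)%R. Proof. by rewrite mulr_gt0 ?subr_gt0. Qed.

Let mF : measurable_fun I01 F.
Proof.
apply: nonincreasing_itv_measurable => x y.
by rewrite !in_itv/= => /andP[x0 _] _ xy; exact: Fni.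
Qed.

Let mpow b : measurable_fun I01 (fun t : R => t `^ b)%R.
Proof. by apply: measurable_funTS; exact: measurable_powR. Qed.

Let mFq : measurable_fun I01 (fun t => F t `^ q)%R.
Proof. by apply: (measurableT_comp (measurable_powR _)). Qed.

Let mkk : measurable_fun I01 kk.
Proof. by apply: measurable_funM => //; exact: mpow. Qed.

Let kk0 u : 0 <= (kk u)%:E.
Proof. by rewrite lee_fin mulr_ge0 ?powR_ge0. Qed.

Let mI s : measurable (I01 `&` [set u | (s < 2 * u)%R]).
Proof.
apply: measurable_superlevel; first exact: measurable_itv.
by apply: measurable_funTS; exact: mulrl_measurable.
Qed.

Let tail_ge0 s : 0 <= tail s.
Proof. exact: integral_ge0. Qed.

Let tail_nincr s s' : (s <= s')%R -> tail s' <= tail s.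
Proof.
move=> ss; apply: ge0_subset_integral => //.
- exact: mI.
- exact: mI.
- by apply/measurable_EFinP; apply: measurable_funS mkk => // x [].
- by move=> u [Iu /= s'u]; split => //=; exact: le_lt_trans ss s'u.
Qed.

Let tail_fin s : (0 < s)%R -> tail s \is a fin_num.
Proof.
move=> s0; rewrite ge0_fin_numE ?tail_ge0//.
apply: (@le_lt_trans _ _ (((s / 2) `^ (- ga))%:E * A)); last first.
  by rewrite lte_mul_pinfty ?lee_fin ?powR_ge0.
have mg : measurable_fun I01 (fun t => (t `^ (al - 1) * F t `^ q)%:E).
  by apply/measurable_EFinP; apply: measurable_funM => //; exact: mpow.
rewrite -ge0_integralZl_EFin//; last 2 first.
- by move=> t _; rewrite lee_fin mulr_ge0 ?powR_ge0.
- exact: powR_ge0.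
apply: (@le_trans _ _ (\int[leb]_(u in I01 `&` [set u | (s < 2 * u)%R])
   (((s / 2) `^ (- ga))%:E * (u `^ (al - 1) * F u `^ q)%:E))).
  apply: le_integral_ge0 => // u [/=]; rewrite in_itv/= => /andP[u0 _] su.
  rewrite -EFinM lee_fin /kk addrAC powRD ?(gt_eqF u0) ?implybT//.
  rewrite mulrAC [leRHS]mulrC; apply: ler_wpM2l;
    first by rewrite mulr_ge0 ?powR_ge0.
  apply: le0_ler_powR; rewrite ?oppr_le0 ?divr_gt0//; first exact: ltW.
  by rewrite ler_pdivrMr// mulrC ltW.
apply: ge0_subset_integral => //.
- exact: mI.
- by apply: measurable_funeM.
- by move=> u _; rewrite mule_ge0// lee_fin ?mulr_ge0 ?powR_ge0.
Qed.

Lemma dual_profile_ge0 s : (0 <= dual_profile s)%R.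
Proof. exact: powR_ge0. Qed.

Lemma dual_profile_nincr s s' : (0 < s)%R -> (s <= s')%R ->
  (dual_profile s' <= dual_profile s)%R.
Proof.
move=> s0 ss; have s'0 := lt_le_trans s0 ss.
apply: ge0_ler_powR; rewrite ?nnegrE ?fine_ge0 ?invr_ge0//; first exact: ltW.
by apply: fine_le; [exact: tail_fin|exact: tail_fin|exact: tail_nincr].
Qed.

Lemma measurable_dual_profile : measurable_fun setT dual_profile.
Proof.
have -> : setT = `]-oo, 0%R]%classic `|` `]0%R, +oo[%classic :> set R.
  apply/seteqP; split => // x _; rewrite /= !in_itv/= andbT.
  by have [x0|x0] := leP x 0%R; [left|right].
apply/measurable_funU => //; split; last first.
  apply: nonincreasing_itv_measurable => x y.
  by rewrite in_itv/= andbT => x0 _; exact: dual_profile_nincr.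
apply: nonincreasing_itv_measurable => x y xI yI _.
have tailE z : z \in `]-oo, 0%R] -> tail z = tail 0.
  rewrite in_itv/= => z0; rewrite /tail (_ : I01 `&` [set u | (z < 2 * u)%R] =
    I01 `&` [set u | (0 < 2 * u)%R])//.
  apply/seteqP; split => u [Iu /= _]; split => //=;
    move: Iu; rewrite /= in_itv/= => /andP[u0 _]; last first.
    by apply: (le_lt_trans z0); rewrite mulr_gt0.
  by rewrite mulr_gt0.
by rewrite /dual_profile !tailE.
Qed.

(** Exchanging the integrals leaves, for each u, the integral of
    s^(ga-1) over (0, 2u), which is (2u)^ga / ga; the exponents are chosen so
    that u^ga compensates the weight in [dual_profile]. *)
Lemma integral_dual_profile_le :
  \int[leb]_(s in I01) (s `^ (ga - 1) * dual_profile s `^ q')%:E <=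
  (2 `^ ga / ga)%:E * A.
Proof.
have dpE s : (0 < s)%R -> (s `^ (ga - 1) * dual_profile s `^ q')%:E =
    (s `^ (ga - 1))%:E * tail s.
  move=> s0; rewrite /dual_profile -powRrM mulVf ?gt_eqF// powRr1 ?fine_ge0//.
  by rewrite EFinM fineK// tail_fin.
have fI : leb I01 < +oo by rewrite leb_I01 ltry.
have mI01 : measurable I01 by exact: measurable_itv.
have mg : measurable_fun I01 (fun t => (t `^ (al - 1) * F t `^ q)%:E).
  by apply/measurable_EFinP; apply: measurable_funM => //; exact: mpow.
apply: (@le_trans _ _ (\int[leb]_(s in `]0%R, +oo[) ((s `^ (ga - 1))%:E * tail
  s))).
  rewrite integral_mkcond [leRHS]integral_mkcond.
  apply: le_integral_ge0 => s _; rewrite /patch.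
    by case: ifPn => // _; rewrite lee_fin mulr_ge0 ?powR_ge0.
  rewrite !mem_setE !in_itv/= andbT.
  have [s0|] := ltP 0%R s; last by [].
  rewrite /=; case: ifPn => _; first by rewrite dpE.
  by rewrite mule_ge0 ?lee_fin ?powR_ge0.
have mw : measurable_fun [set: R] (fun s : R => (s `^ (ga - 1))%:E).
  by apply/measurable_EFinP; exact: measurable_powR.
have w0 (s : R) : 0 <= (s `^ (ga - 1))%:E by rewrite lee_fin powR_ge0.
have mphi : measurable_fun I01 (fun u : R => 2 * u)%R.
  by apply: measurable_funTS; exact: mulrl_measurable.
have mkk' : measurable_fun I01 (EFin \o kk) by exact/measurable_EFinP.
rewrite -(@layer_cake _ _ _ leb I01 mI01 fI _ _ _ mkk' (fun u _ =>
  kk0 u) mw w0 mphi).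
rewrite -ge0_integralZl_EFin//; last 2 first.
- by move=> t _; rewrite lee_fin mulr_ge0 ?powR_ge0.
- by rewrite divr_ge0 ?powR_ge0// ltW.
apply: le_integral_ge0 => u.
  move=> _; apply: mule_ge0; first exact: kk0.
  by apply: integral_ge0 => s _; rewrite lee_fin powR_ge0.
rewrite /= in_itv/= => /andP[u0 _].
apply: (@le_trans _ _ ((kk u)%:E * ((2 * u) `^ ga / ga)%:E)).
  by apply: lee_wpmul2l => //; exact: integral_powR_le.
rewrite -!EFinM lee_fin /kk powRM ?(ltW u0)//.
rewrite (_ : al - 1 = al - ga - 1 + ga)%R; last by ring.
rewrite (@powRD _ _ _ ga) ?(gt_eqF u0) ?implybT//.
by rewrite le_eqVlt; apply/orP; left; apply/eqP; ring.
Qed.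

(** On (T/2, T), where T = tau(F(t)), the function F is at least F(t) and the
    power of u is comparable to that of T. *)
Lemma le_dual_profile t : (0 < t)%R -> (t < 1)%R ->
  (2 `^ (1 - q) * (tau (F t) `^ (al - 1) * F t `^ (q - 1)) <=
   dual_profile (tau (F t)))%R.
Proof.
move=> t0 t1; set T := tau (F t).
have T0 : (0 < T)%R by exact: lt_le_trans (le_plateau_end Fni t0 t1).
have T1 : (T <= 1)%R by exact: plateau_end_le1.
pose b := (al - ga)%R.
have bE : (b = q * (a * q - 1) / (q - 1))%R.
  by rewrite /b /al /ga /q'; field; rewrite gt_eqF.
have bq : (b <= q)%R.
  rewrite bE ler_pdivrMr// ler_pM2l// lerB// -[leRHS]mul1r.
  by rewrite ler_wpM2r// ltW.
(* [2 `^ (1 - q)] bounds (u / T)^(b - 1) from below for T/2 < u < T, as b <= q. *)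
pose c := (T `^ (b - 1) * 2 `^ (1 - q) * F t `^ q)%R.
have key : (2 `^ (- q) * T `^ b * F t `^ q <= fine (tail T))%R.
  rewrite -lee_fin fineK ?tail_fin//.
  apply: (@le_trans _ _ (\int[leb]_(u in `](T / 2)%R, T[) c%:E)).
    have -> : \int[leb]_(u in `](T / 2)%R, T[) c%:E =
      c%:E * leb `](T / 2)%R, T[%classic.
      by rewrite integral_cst.
    rewrite lebesgue_measure_itv/= lte_fin ltr_pdivrMr// ltr_pMr// ltr1n.
    rewrite -EFinD -EFinM lee_fin le_eqVlt; apply/orP; left; apply/eqP.
    rewrite /c (_ : 1 - q = - q + 1)%R; last by ring.
    rewrite (_ : T - T / 2 = T / 2)%R; last by field.
    rewrite (@powRD _ 2) ?pnatr_eq0 ?implybT// powRr1//.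
    rewrite (@powRB _ T b 1%R) ?(gt_eqF T0) ?implybT// powRr1 ?(ltW T0)//.
    by field; rewrite gt_eqF.
  apply: (@le_trans _ _ (\int[leb]_(u in `](T / 2)%R, T[) (kk u)%:E)).
    apply: le_integral_ge0 => u; first by move=> _;
      rewrite lee_fin !mulr_ge0 ?powR_ge0.
    rewrite /= in_itv/= => /andP[Tu uT]; have u0 : (0 < u)%R.
      by rewrite (lt_trans _ Tu)// divr_gt0.
    rewrite lee_fin /c /kk -/b; apply: ler_pM; rewrite ?mulr_ge0 ?powR_ge0//;
      last first.
      apply: ge0_ler_powR; rewrite ?nnegrE//; first exact: ltW.
      exact: (plateau_end_lt Fni u0 uT).
    have [b1|b1] := leP b 1%R.
      rewrite (@le_trans _ _ (T `^ (b - 1))%R)//.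
        rewrite ger_pMr ?powR_gt0// -[leRHS](powRr0 2) ler_powR//.
          by rewrite ler1n.
        by rewrite subr_le0 ltW.
      by apply: le0_ler_powR; rewrite ?subr_le0// ltW.
    apply: (@le_trans _ _ ((T / 2) `^ (b - 1))%R); last first.
      by apply: ge0_ler_powR; rewrite ?nnegrE ?subr_ge0 ?divr_ge0// ltW.
    rewrite powRM ?invr_ge0 ?(ltW T0)//; apply: ler_wpM2l;
      first exact: powR_ge0.
    rewrite -(@powR_inv1 _ 2)// -powRrM; apply: ler_powR;
      first by rewrite ler1n.
    by rewrite mulN1r opprB lerB.
  apply: ge0_subset_integral => //.
  - exact: mI.
  - by apply/measurable_EFinP; apply: measurable_funS mkk => // u [].
  - move=> u; rewrite /= !in_itv/= => /andP[Tu uT]; split; last first.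
      by rewrite mulrC -ltr_pdivrMr.
    by rewrite (lt_le_trans uT)// (lt_trans _ Tu)// divr_gt0.
have qq : (q * q'^-1 = q - 1)%R by rewrite /q'; field; rewrite !gt_eqF.
have bq' : (b * q'^-1 = al - 1)%R by rewrite bE /al /q'; field; rewrite !gt_eqF.
have -> : (2 `^ (1 - q) * (T `^ (al - 1) * F t `^ (q - 1)) =
    (2 `^ (- q) * T `^ b * F t `^ q) `^ q'^-1)%R.
  rewrite !powRM ?mulr_ge0 ?powR_ge0// -!powRrM qq bq' mulNr qq opprB.
  by rewrite mulrA.
by apply: ge0_ler_powR; rewrite ?nnegrE ?mulr_ge0 ?powR_ge0 ?fine_ge0
  ?invr_ge0// ltW.
Qed.

End dual_profile.

(** * Rearrangements of functions of f *)

Section composition.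
Context d (T : measurableType d) (R : realType).
Variables (mu : {measure set T -> \bar R}) (D : set T).
Hypotheses (mD : measurable D) (Dfin : mu D < +oo).
Local Notation leb := (@lebesgue_measure R).
Local Notation I01 := (`]0%R, 1%R[%classic : set R).
Local Notation "f ^#" := (drearr mu D f) (at level 2, format "f ^#").
Implicit Types (f g : T -> R) (Phi h : R -> R).

Let m := fine (mu D).
Let mE : mu D = m%:E. Proof. by rewrite /m fineK// ge0_fin_numE. Qed.
Let m0 : (0 <= m)%R. Proof. by rewrite -lee_fin -mE. Qed.

Let leb_mono (A B : set R) : measurable A -> measurable B -> A `<=` B ->
  leb A <= leb B.
Proof. by move=> mA mB AB; apply: le_measure; rewrite ?inE. Qed.

(** The superlevel set {|g| > h(t)} is contained in {Phi(|f|) > h(t)}, which by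
    equimeasurability has the size of {u : Phi(f#(u)) > h(t)}; and u >= t would
    force Phi(f#(u)) <= h(u) <= h(t). *)
Lemma drearr_comp_le f g Phi h t : measurable_fun D f -> measurable_fun D g ->
  measurable_fun setT Phi ->
  (forall x, D x -> (`|g x| <= Phi `|f x|)%R) ->
  (forall s, (0 <= h s)%R) ->
  (forall s s', (0 < s)%R -> (s <= s')%R -> (h s' <= h s)%R) ->
  (forall s, (0 < s)%R -> (s < 1)%R -> (Phi (f^# s) <= h s)%R) ->
  (0 < t)%R -> (t < 1)%R -> (g^# t <= h t)%R.
Proof.
move=> mf mg mPhi gPhi h0 hni Phih t0 t1.
have mabs : measurable_fun D (fun x => `|f x|%R) by exact: measurableT_comp.
apply/drearr_le => //.
have mA : measurable (setT `&` [set s | (h t < Phi s)%R]) by exact: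
  measurable_superlevel.
rewrite setTI in mA.
have mAs : measurable (I01 `&` drearr mu D f @^-1` [set s | (h t < Phi s)%R]).
  exact: measurable_drearr.
apply: (@le_trans _ _ (mu (D `&` (fun x => `|f x|%R) @^-1` [set s | (h t < Phi
  s)%R]))).
  apply: le_measure; rewrite ?inE.
  - by apply: measurable_superlevel => //; exact: measurableT_comp.
  - exact: mabs.
  - by move=> x [Dx /= htg]; split => //=; exact: lt_le_trans htg (gPhi _ Dx).
rewrite drearr_preimage// -/m -mE muleC; apply: lee_wpmul2r;
  first by rewrite mE lee_fin.
apply: (@le_trans _ _ (leb `]0%R, t[%classic)).
  apply: leb_mono => // s [/=]; rewrite !in_itv/= => /andP[s0 s1] htPhi.
  rewrite s0 ltNge; apply/negP => ts.
  have := lt_le_trans htPhi (le_trans (Phih _ s0 s1) (hni _ _ t0 ts)).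
  by rewrite ltxx.
by rewrite lebesgue_measure_itv/= lte_fin t0 oppr0 adde0.
Qed.

Lemma integral_drearr_comp_le f Phi : measurable_fun D f ->
  measurable_fun setT Phi -> (forall s, (0 <= Phi s)%R) ->
  mu D * \int[leb]_(t in I01) (f^# t * Phi (f^# t))%:E <=
  \int[mu]_(x in D) (`|f x| * Phi `|f x|)%:E.
Proof.
move=> mf mPhi Phi0.
have mfs := measurable_drearr mD Dfin mf.
have mPhis : measurable_fun I01 (fun t => Phi (f^# t)) by exact:
  measurableT_comp.
have mabs : measurable_fun D (fun x => `|f x|%R) by exact: measurableT_comp.
have mI01 : measurable I01 by exact: measurable_itv.
rewrite mE -(ge0_integral_mscale leb mI01 (NngNum m0))//; last 2 first.
- by apply/measurable_EFinP; exact: measurable_funM.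
- by move=> t _; rewrite lee_fin mulr_ge0// drearr_ge0.
apply: (@le_integral_superlevel _ _ _ _ R (mscale (NngNum m0) leb) mu) => //.
- by rewrite /= /mscale /= leb_I01 mule1 ltry.
- by move=> t _; exact: drearr_ge0.
- exact: measurableT_comp.
move=> s u; rewrite /= /mscale /=.
have mA : measurable ((setT `&` [set r | (s < Phi r)%R]) `&` (setT `&` [set r :
  R | (u < r)%R])).
  by apply: measurableI; apply: measurable_superlevel.
rewrite !setTI in mA.
by rewrite -!setIA; have <- := drearr_preimage mD Dfin mf mA.
Qed.

Lemma drearr0 f t : measurable_fun D f -> mu D = 0 -> (0 < t)%R -> f^# t = 0%R.
Proof.
move=> mf muD0 t0; apply/eqP; rewrite eq_le drearr_ge0 andbT.
apply/drearr_le => //; rewrite muD0 mule0 -muD0.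
apply: le_measure; rewrite ?inE//.
by apply: measurable_superlevel => //; exact: measurableT_comp.
Qed.

Lemma drearrZ_le f k t : measurable_fun D f -> (0 <= k)%R -> (0 < t)%R ->
  ((fun x => k * f x)%R ^# t <= k * f^# t)%R.
Proof.
move=> mf k0 t0.
have mkf : measurable_fun D (fun x => k * f x)%R by exact: measurable_funM.
apply/drearr_le => //; first by rewrite mulr_ge0 ?drearr_ge0.
apply: (@le_trans _ _ (mu (D `&` [set x | (f^# t < `|f x|)%R]))).
  apply: le_measure; rewrite ?inE.
  - by apply: measurable_superlevel => //; exact: measurableT_comp.
  - by apply: measurable_superlevel => //; exact: measurableT_comp.
  - move=> x [Dx /=]; rewrite normrM (ger0_norm k0) => H; split => //=.
    rewrite ltNge; apply: contraTN H; rewrite -leNgt => H.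
    exact: ler_wpM2l.
by apply/drearr_le => //; exact: drearr_ge0.
Qed.

Lemma lorentz_integral_le a (b : R) (q : \bar R) (k : R) f g :
  measurable_fun D f -> measurable_fun D g -> 0 < q -> (0 <= k)%R ->
  (forall t, (0 < t)%R -> (t < 1)%R ->
     (t `^ a * f^# t <= k * (t `^ b * g^# t))%R) ->
  lorentz_integral mu D a q f <= k%:E * lorentz_integral mu D b q g.
Proof.
move=> mf mg; case: q => [q||//]; rewrite ?lte_fin => q0 k0 fg; last first.
  rewrite (lorentz_integral_inftyE mD Dfin a mf) (lorentz_integral_inftyE mD
    Dfin b mg).
  apply: ge_ereal_sup => _ [t /= + <-]; rewrite in_itv/= => /andP[t0 t1].
  apply: (@le_trans _ _ (k%:E * (t `^ b * g^# t)%:E));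
    first by rewrite -EFinM lee_fin fg.
  apply: lee_wpmul2l; first by rewrite lee_fin.
  by apply: ereal_sup_ubound; exists t => //=; rewrite in_itv/= t0.
rewrite (lorentz_integralE mD Dfin a mf q0) (lorentz_integralE mD Dfin b mg q0).
have mgs := measurable_drearr mD Dfin mg.
have {1}-> : k%:E = (k `^ q)%:E `^ q^-1.
  by rewrite poweR_EFin -powRrM divff ?gt_eqF// powRr1.
have int0 (c : R) (h : T -> R) : 0 <= \int[leb]_(t in I01) (t `^ (c * q - 1) *
  h^# t `^ q)%:E.
  by apply: integral_ge0 => t _; rewrite lee_fin mulr_ge0 ?powR_ge0.
rewrite -poweRM ?lee_fin ?powR_ge0//.
apply: gt0_ler_poweR; rewrite ?invr_ge0 ?(ltW q0)// ?in_itv/= ?leey ?int0//.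
  by rewrite mule_ge0 ?lee_fin ?powR_ge0.
rewrite -ge0_integralZl_EFin//; last 3 first.
- by move=> t _; rewrite lee_fin mulr_ge0 ?powR_ge0.
- apply/measurable_EFinP; apply: measurable_funM.
    by apply: measurable_funTS; exact: measurable_powR.
  by apply: (measurableT_comp (measurable_powR _)).
- exact: powR_ge0.
apply: le_integral_ge0 => t; first by rewrite lee_fin mulr_ge0 ?powR_ge0.
rewrite /= in_itv/= => /andP[t0 t1]; rewrite -EFinM lee_fin.
have tq (c : R) (h : T -> R) : (t `^ (c * q - 1) * h^# t `^ q =
  (t `^ c * h^# t) `^ q / t)%R.
  rewrite powRM ?powR_ge0 ?drearr_ge0// -powRrM powRB ?(gt_eqF t0) ?implybT//.
  by rewrite powRr1 ?(ltW t0)// mulrAC.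
rewrite (tq a f) (tq b g) mulrA.
have tg0 : (0 <= t `^ b * g^# t)%R by rewrite mulr_ge0 ?powR_ge0 ?drearr_ge0.
rewrite -(@powRM _ k _ q k0 tg0).
apply: ler_wpM2r; first by rewrite invr_ge0 ltW.
apply: ge0_ler_powR; rewrite ?nnegrE ?mulr_ge0 ?powR_ge0 ?drearr_ge0//;
  first exact: ltW.
exact: fg.
Qed.

End composition.

(** * The upper estimate *)

(** For K = 0 the nonemptiness of S matters: the infimum could be infinite,
    and 0 times infinity is 0 by convention. *)
Lemma le_mul_ereal_inf (R : realType) (K : R) (x : \bar R) (S : set (\bar R)) :
  (0 <= K)%R -> S !=set0 -> (forall y, S y -> x <= K%:E * y) ->
  x <= K%:E * ereal_inf S.
Proof.
move=> K0 [y0 Sy0] xK; move: K0; rewrite le_eqVlt => /predU1P[K0|K0].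
  by have := xK _ Sy0; rewrite -K0 !mul0e.
rewrite -lee_pdivrMl//; apply: le_ereal_inf_tmp => y Sy.
by rewrite lee_pdivrMl// xK.
Qed.

Section koethe.
Context d (T : measurableType d) (R : realType).
Variables (mu : {measure set T -> \bar R}) (D : set T).
Hypotheses (mD : measurable D) (Dfin : mu D < +oo).
Variables (p q theta : R).
Hypotheses (p1 : (1 < p)%R) (q1 : (1 <= q)%R) (theta0 : (0 < theta)%R).
Local Notation leb := (@lebesgue_measure R).
Local Notation I01 := (`]0%R, 1%R[%classic : set R).
Local Notation "f ^#" := (drearr mu D f) (at level 2, format "f ^#").
Local Notation q' := (hoelder_conjugate q%:E).
Local Notation p' := (hoelder_conjugate p%:E).
Local Notation N := (GLnorm mu D theta p%:E q%:E).
Local Notation Y := (GL mu D (- theta) p' q').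
Local Notation M := (GLnorm mu D (- theta) p' q').
Local Notation L := (lorentz_integral mu D).
Implicit Types (f g : T -> R) (e : R).

Let m := fine (mu D).
Let mE : mu D = m%:E. Proof. by rewrite /m fineK// ge0_fin_numE. Qed.
Let p0 : (0 < p)%R. Proof. exact: lt_trans p1. Qed.
Let q0 : (0 < q)%R. Proof. exact: lt_le_trans q1. Qed.
Let pV1 : (p^-1 < 1)%R. Proof. by rewrite invf_lt1. Qed.
Let pV0 : (0 < p^-1)%R. Proof. by rewrite invr_gt0. Qed.
Let q'0 : 0 < q'.
Proof. by apply: (@lt_le_trans _ _ 1) => //; apply: hoelder_conj_ge1;
  rewrite lee_fin. Qed.

Lemma GLnormE f : N f =
  ereal_sup [set (e `^ theta)%:E * L (p^-1 + e)%R q%:E f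
            | e in [set e : R | (0 < e < 1)%R]].
Proof. by rewrite /GLnorm (ltW theta0) inver (gt_eqF p0). Qed.

Lemma dual_GLnormE g : M g =
  ereal_inf [set (e `^ (- theta))%:E * L (1 - (p^-1 + e))%R q' g
            | e in [set e : R | (0 < e < 1 - p^-1)%R]].
Proof.
have p10 : (0 < p - 1)%R by rewrite subr_gt0.
have -> : p' = (p / (p - 1))%:E.
  by rewrite /hoelder_conjugate/= eqe (gt_eqF p0) -EFinD inver (gt_eqF p10).
rewrite /GLnorm leNgt oppr_lt0 theta0/= inver (gt_eqF (divr_gt0 p0 p10))/=.
have -> : ((p / (p - 1))^-1 = 1 - p^-1)%R by field;
  rewrite (gt_eqF p0) (gt_eqF p10).
have eE e : (1 - p^-1 - e = 1 - (p^-1 + e))%R by rewrite opprD addrA.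
congr ereal_inf.
apply: eq_imagel => e _.
by rewrite eE.
Qed.

Lemma GLnorm_ge0 f : measurable_fun D f -> 0 <= N f.
Proof.
move=> mf; rewrite GLnormE; apply: le_ereal_sup_tmp.
exists ((2^-1 `^ theta)%:E * L (p^-1 + 2^-1)%R q%:E f).
  by exists 2^-1%R => //=; rewrite invr_gt0 ltr0n invf_lt1// ltr1n.
by rewrite mule_ge0 ?lee_fin ?powR_ge0 ?lorentz_integral_ge0.
Qed.

Let dual_set_neq0 g : [set (e `^ (- theta))%:E * L (1 - (p^-1 + e))%R q' g
            | e in [set e : R | (0 < e < 1 - p^-1)%R]] !=set0.
Proof.
have h0 : (0 < 1 - p^-1)%R by rewrite subr_gt0.
exists ((((1 - p^-1) / 2) `^ (- theta))%:E *
  L (1 - (p^-1 + (1 - p^-1) / 2))%R q' g).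
exists ((1 - p^-1) / 2)%R => //=.
by rewrite divr_gt0//= ltr_pdivrMr// ltr_pMr// ltr1n.
Qed.

Lemma dual_GLnorm_ge0 g : measurable_fun D g -> 0 <= M g.
Proof.
move=> mg; rewrite dual_GLnormE; apply: le_ereal_inf_tmp => _ [e _ <-].
by rewrite mule_ge0 ?lee_fin ?powR_ge0 ?lorentz_integral_ge0.
Qed.

Lemma integral_le_GLnorm_lorentz f g e : measurable_fun D f ->
  measurable_fun D g ->
  (0 < e)%R -> (e < 1 - p^-1)%R ->
  \int[mu]_(x in D) `|f x * g x|%:E <=
  mu D * N f * ((e `^ (- theta))%:E * L (1 - (p^-1 + e))%R q' g).
Proof.
move=> mf mg e0 ep; have e1 : (e < 1)%R by rewrite (lt_trans ep)// gtrBl.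
apply: (le_trans (hardy_littlewood mD Dfin mf mg)); rewrite -muleA.
apply: lee_wpmul2l => //.
apply: (le_trans (hoelder_lorentz mD Dfin (p^-1 + e) mf mg q1)).
have Lg0 : 0 <= L (1 - (p^-1 + e))%R q' g by exact: lorentz_integral_ge0.
apply: (@le_trans _ _ (((e `^ theta)%:E * L (p^-1 + e)%R q%:E f) *
  ((e `^ (- theta))%:E * L (1 - (p^-1 + e))%R q' g))).
  rewrite muleACA -EFinM -powRD ?(gt_eqF e0) ?implybT// subrr powRr0 mul1e.
  exact: lexx.
apply: lee_wpmul2r; first by rewrite mule_ge0 ?lee_fin ?powR_ge0.
by rewrite GLnormE; apply: ereal_sup_ubound; exists e => //=; rewrite e0.
Qed.

Lemma integral_le_GLnorm f g : measurable_fun D f -> measurable_fun D g ->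
  N f < +oo ->
  \int[mu]_(x in D) `|f x * g x|%:E <= mu D * N f * M g.
Proof.
move=> mf mg Nf; have N0 := GLnorm_ge0 mf.
rewrite dual_GLnormE -(fineK (_ : N f \is a fin_num)) ?ge0_fin_numE// mE -EFinM.
apply: le_mul_ereal_inf; [by rewrite mulr_ge0// fine_ge0|exact: dual_set_neq0|].
move=> _ [e /andP[e0 ep] <-]; rewrite EFinM -mE fineK ?ge0_fin_numE//.
exact: integral_le_GLnorm_lorentz.
Qed.

(** If N(f) is infinite, the right-hand side is infinite too, unless D is
    a null set; in that case the estimate with a fixed e gives 0 on the left. *)
Lemma integral_le_GLnorm_unit f g : measurable_fun D f -> measurable_fun D g ->
  M g = 1 -> \int[mu]_(x in D) `|f x * g x|%:E <= mu D * N f.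
Proof.
move=> mf mg Mg1; have [Nf|] := ltP (N f) +oo.
  by have := integral_le_GLnorm mf mg Nf; rewrite Mg1 mule1.
rewrite leye_eq => /eqP Nf.
have [muD0|muD0] := eqVneq (mu D) 0; last first.
  by rewrite Nf gt0_muley ?leey// lt0e muD0 measure_ge0.
have [_ [e /andP[e0 ep] _]] := dual_set_neq0 g.
by have := integral_le_GLnorm_lorentz mf mg e0 ep; rewrite muD0 !mul0e.
Qed.

Lemma koethe_norm_le f : measurable_fun D f ->
  koethe_norm mu D Y M f <= mu D * N f.
Proof.
move=> mf; rewrite /koethe_norm /sup_ge0 ge_max mule_ge0 ?GLnorm_ge0//=.
by apply: ge_ereal_sup => _ [g [[mg _] Mg] <-]; exact: integral_le_GLnorm_unit.
Qed.

Lemma pairing_le_koethe_norm f : measurable_fun D f ->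
  pairing_norm mu D Y M f <= koethe_norm mu D Y M f.
Proof.
move=> mf; rewrite /koethe_norm /pairing_norm /sup_ge0 ge_max le_max lexx/=.
apply: ge_ereal_sup => _ [g [Yg Mg] <-]; have [mg _] := Yg.
rewrite le_max; apply/orP; right.
apply: (@le_trans _ _ (\int[mu]_(x in D) `|f x * g x|%:E)); last first.
  by apply: ereal_sup_ubound; exists g.
apply: le_trans (lee_abs _) _; apply: le_abse_integral => //.
by apply/measurable_EFinP; exact: measurable_funM.
Qed.

Lemma dual_GLnormZ_le g (k : R) : measurable_fun D g -> (0 <= k)%R ->
  M (fun x => k * g x)%R <= k%:E * M g.
Proof.
move=> mg k0; rewrite [in leRHS]dual_GLnormE.
apply: le_mul_ereal_inf; [by []|exact: dual_set_neq0|].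
move=> _ [e /andP[e0 ep] <-]; rewrite dual_GLnormE; apply: ge_ereal_inf.
exists ((e `^ (- theta))%:E * L (1 - (p^-1 + e))%R q' (fun x => k * g x)%R).
  by exists e => //=; rewrite e0.
rewrite muleCA; apply: lee_wpmul2l; first by rewrite lee_fin powR_ge0.
apply: lorentz_integral_le => //; first exact: measurable_funM.
move=> t t0 t1; rewrite mulrCA; apply: ler_wpM2l; first exact: powR_ge0.
exact: drearrZ_le.
Qed.

Lemma dual_GLnormZ g (k : R) : measurable_fun D g -> (0 < k)%R ->
  M (fun x => k * g x)%R = k%:E * M g.
Proof.
move=> mg k0; apply/eqP; rewrite eq_le dual_GLnormZ_le ?(ltW k0)//=.
have mkg : measurable_fun D (fun x => k * g x)%R by exact: measurable_funM.
rewrite -lee_pdivlMl//; have /= := @dual_GLnormZ_le _ k^-1 mkg.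
under [X in M X]eq_fun do rewrite mulKf ?gt_eqF//.
by apply; rewrite invr_ge0 ltW.
Qed.

Lemma lorentz_integral_cst1_le a : (0 < a)%R ->
  L a q%:E (cst 1%R) <= (((a * q)^-1) `^ q^-1)%:E.
Proof.
move=> a0; have aq0 : (0 < a * q)%R by rewrite mulr_gt0.
rewrite lorentz_integralE// -poweR_EFin.
have int0 : 0 <= \int[leb]_(t in I01) (t `^ (a * q - 1) * (cst 1%R)^# t `^
  q)%:E.
  by apply: integral_ge0 => t _; rewrite lee_fin mulr_ge0 ?powR_ge0.
apply: gt0_ler_poweR; rewrite ?invr_ge0 ?(ltW q0)// ?in_itv/= ?leey ?int0//.
  by rewrite lee_fin invr_ge0 ltW.
apply: (@le_trans _ _ (\int[leb]_(t in I01) (t `^ (a * q - 1))%:E)).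
  apply: le_integral_ge0 => t; first by rewrite lee_fin mulr_ge0 ?powR_ge0.
  rewrite /= in_itv/= => /andP[t0 t1]; rewrite lee_fin ler_piMr ?powR_ge0//.
  apply: (@le_trans _ _ (1 `^ q)%R); last by rewrite powR1.
  apply: ge0_ler_powR; rewrite ?nnegrE ?drearr_ge0//; first exact: ltW.
  apply/drearr_le => //; rewrite (_ : D `&` _ =
    set0) ?measure0 ?mule_ge0 ?lee_fin ?(ltW t0)//.
  by rewrite -subset0 => x [_ /=]; rewrite normr1 ltxx.
by apply: (le_trans (integral_powR_le 1 aq0)); rewrite powR1 div1r.
Qed.

Lemma GLnorm_cst1_lty : N (cst 1%R) < +oo.
Proof.
rewrite GLnormE; apply: (@le_lt_trans _ _ (((p^-1 * q)^-1) `^ q^-1)%:E);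
  last exact: ltry.
apply: ge_ereal_sup => _ [e /andP[e0 e1] <-].
have pe0 : (0 < p^-1 + e)%R by rewrite addr_gt0.
apply: (@le_trans _ _ (1 * L (p^-1 + e)%R q%:E (cst 1%R))).
  apply: lee_wpmul2r; first exact: lorentz_integral_ge0.
  rewrite lee_fin; apply: (@le_trans _ _ (1 `^ theta)%R); last by rewrite powR1.
  by apply: ge0_ler_powR; rewrite ?nnegrE ?(ltW theta0) ?(ltW e0) ?(ltW e1).
rewrite mul1e; apply: (le_trans (lorentz_integral_cst1_le pe0));
  rewrite lee_fin.
apply: ge0_ler_powR; rewrite ?nnegrE ?invr_ge0 ?mulr_ge0 ?(ltW q0) ?(ltW pV0)
  ?(ltW pe0)//.
by rewrite lef_pV2 ?posrE ?mulr_gt0// ler_pM2r// lerDl ltW.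
Qed.

(** By homogeneity one can divide g by M(g), provided that M(g) is not 0. If
    M(g) = 0, the upper estimate with f = 1 shows that g vanishes almost
    everywhere. *)
Lemma integral_le_pairing_norm f g : measurable_fun D f -> measurable_fun D g ->
  (forall x, D x -> (0 <= f x * g x)%R) -> M g < +oo ->
  \int[mu]_(x in D) (f x * g x)%:E <= pairing_norm mu D Y M f * M g.
Proof.
move=> mf mg fg0 Mg.
have mfg : measurable_fun D (fun x => (f x * g x)%:E).
  by apply/measurable_EFinP; exact: measurable_funM.
have [Mg0|Mg0] := eqVneq (M g) 0.
  have := integral_le_GLnorm (@measurable_cst _ _ T (measurableTypeR R) D 1%R)
    mg GLnorm_cst1_lty.
  rewrite Mg0 !mule0 => H.
  have H0 : \int[mu]_(x in D) `|(g x)%:E| = 0.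
    apply/eqP; rewrite eq_le integral_ge0// andbT.
    by under eq_integral do [rewrite abse_EFin -[g _]mul1r].
  have /(ae_eq_integral_abs mu mD) Hae : measurable_fun D (EFin \o g).
    exact/measurable_EFinP.
  have {}Hae := Hae.1 H0.
  rewrite (_ : \int[mu]_(x in D) (f x * g x)%:E = \int[mu]_(x in D) (cst 0) x).
    by rewrite integral0.
  apply: ae_eq_integral => //; apply: filterS Hae => x Hx Dx.
  have /= := Hx Dx.
  by rewrite /= => -[->]; rewrite mulr0.
have Mg1 : 0 < M g by rewrite lt0e Mg0 dual_GLnorm_ge0.
have Mgfin : M g \is a fin_num by rewrite ge0_fin_numE// ltW.
pose k := fine (M g); have k0 : (0 < k)%R by rewrite fine_gt0// Mg1.
have kE : M g = k%:E by rewrite fineK.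
pose g' := fun x => (k^-1 * g x)%R.
have mg' : measurable_fun D g' by exact: measurable_funM.
have Mg' : M g' = 1 by rewrite /g' dual_GLnormZ ?invr_gt0// kE -EFinM mulVf
  ?gt_eqF.
have -> : \int[mu]_(x in D) (f x * g x)%:E = k%:E * \int[mu]_(x in D) (f x * g'
  x)%:E.
  rewrite -ge0_integralZl_EFin//; last 3 first.
  - move=> x Dx; rewrite lee_fin /g' mulrCA mulr_ge0 ?invr_ge0 ?fg0//;
    exact: ltW.
  - by apply/measurable_EFinP; exact: measurable_funM.
  - exact: ltW.
  apply: eq_integral => x _; rewrite -EFinM; congr (_%:E).
  by rewrite /g'; field; rewrite gt_eqF.
rewrite kE muleC; apply: lee_wpmul2r; first by rewrite lee_fin ltW.
rewrite /pairing_norm /sup_ge0 le_max; apply/orP; right.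
apply: ereal_sup_ubound; exists g'; last by [].
by split; [split; [exact: mg'|rewrite Mg' ltry]|exact: Mg'].
Qed.

End koethe.

(** * The dual function *)

Section lower_bound.
Context d (T : measurableType d) (R : realType).
Variables (mu : {measure set T -> \bar R}) (D : set T).
Hypotheses (mD : measurable D) (Dfin : mu D < +oo).
Local Notation leb := (@lebesgue_measure R).
Local Notation I01 := (`]0%R, 1%R[%classic : set R).
Local Notation "f ^#" := (drearr mu D f) (at level 2, format "f ^#").
Local Notation L := (lorentz_integral mu D).
Implicit Types (f g : T -> R).

(** For q = 1 the extremal function t^(a-1) is itself decreasing, so that
    [dual_profile] is used for q > 1 only. *)
Lemma exists_dual_profile (F : R -> R) (a q de : R) :
  (forall t, (0 <= F t)%R) ->
  (forall t u, (0 < t)%R -> (t <= u)%R -> (F u <= F t)%R) ->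
  (1 <= q)%R -> (0 < a)%R -> (0 < de)%R -> (de <= 1 - a)%R ->
  let A := \int[leb]_(t in I01) (t `^ (a * q - 1) * F t `^ q)%:E in
  A < +oo ->
  exists h : R -> R,
  [/\ forall s, (0 <= h s)%R,
      forall s s', (0 < s)%R -> (s <= s')%R -> (h s' <= h s)%R,
      measurable_fun setT h,
      forall t, (0 < t)%R -> (t < 1)%R ->
        (2 `^ (1 - q) * (plateau_end F (F t) `^ (a * q - 1) * F t `^ (q - 1)) <=
         h (plateau_end F (F t)))%R
    & forall g, measurable_fun D g ->
        (forall t, (0 < t)%R -> (t < 1)%R -> (g^# t <= h t)%R) ->
        L (1 - a)%R (hoelder_conjugate q%:E) g <= (2 / de)%:E * A `^ (1 -
          q^-1)].
Proof.
move=> F0 Fni q1 a0 de0 dea A Afin.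
have a1 : (a < 1)%R by rewrite -subr_gt0 (lt_le_trans de0).
have a10 : (0 < 1 - a)%R by rewrite subr_gt0.
have de1 : (de <= 1)%R by rewrite (le_trans dea)// gerBl ltW.
have q0 : (0 < q)%R by exact: lt_le_trans q1.
have A0 : 0 <= A by apply: integral_ge0 => t _;
  rewrite lee_fin mulr_ge0 ?powR_ge0.
move: q1; rewrite le_eqVlt => /predU1P[q1|q1].
  exists (fun t => t `^ (a - 1))%R; split.
  - by move=> s; exact: powR_ge0.
  - by move=> s s' s0 ss; apply: le0_ler_powR => //; rewrite subr_le0 ltW.
  - exact: measurable_powR.
  - by move=> t t0 t1; rewrite -q1 mulr1 subrr !powRr0 mulr1 mul1r.
  - move=> g mg gh; rewrite -q1 hoelder_conjugate1 invr1 subrr poweRe0 mule1.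
    rewrite (lorentz_integral_inftyE mD Dfin _ mg).
    apply: ge_ereal_sup => _ [t /= + <-]; rewrite in_itv/= => /andP[t0 t1].
    rewrite lee_fin; apply: (@le_trans _ _ (t `^ (1 - a) * t `^ (a - 1))%R).
      by apply: ler_wpM2l; [exact: powR_ge0|exact: gh].
    rewrite -powRD ?(gt_eqF t0) ?implybT// subrKA subrr powRr0.
    by rewrite ler_pdivlMr// mul1r (le_trans de1)// ler1n.
have q10 : (0 < q - 1)%R by rewrite subr_gt0.
exists (dual_profile F a q); split.
- by move=> s; exact: dual_profile_ge0.
- by move=> s s'; exact: dual_profile_nincr.
- exact: measurable_dual_profile.
- by move=> t t0 t1; exact: le_dual_profile.
move=> g mg gh.
set r := (q / (q - 1))%R; have r0 : (0 < r)%R by rewrite divr_gt0.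
have -> : hoelder_conjugate q%:E = r%:E.
  by rewrite /hoelder_conjugate/= eqe (gt_eqF q0) -EFinD inver (gt_eqF q10).
have rV : (1 - q^-1 = r^-1)%R.
  by rewrite /r; field; rewrite (gt_eqF q0) (gt_eqF q10).
rewrite rV (lorentz_integralE mD Dfin _ mg r0).
pose ga := ((1 - a) * r)%R.
have r1 : (1 <= r)%R by rewrite ler_pdivlMr// mul1r gerBl.
have ga0 : (0 < ga)%R by rewrite mulr_gt0.
have gade : (de <= ga)%R by rewrite (le_trans dea)// ler_peMr// ltW.
have c0 : (0 <= 2 `^ ga / ga)%R by rewrite divr_ge0 ?powR_ge0 ?(ltW ga0).
have key : \int[leb]_(t in I01) (t `^ ((1 - a) * r - 1) * g^# t `^ r)%:E <=
    (2 `^ ga / ga)%:E * A.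
  apply: le_trans (integral_dual_profile_le Fni q1 a1 Afin).
  apply: le_integral_ge0 => t; first by rewrite lee_fin mulr_ge0 ?powR_ge0.
  rewrite /= in_itv/= => /andP[t0 t1]; rewrite lee_fin.
  apply: ler_wpM2l; first exact: powR_ge0.
  apply: ge0_ler_powR; rewrite ?nnegrE ?drearr_ge0 ?dual_profile_ge0 ?(ltW
    r0)//.
  exact: gh.
apply: (@le_trans _ _ (((2 `^ ga / ga)%:E * A) `^ r^-1)).
  apply: gt0_ler_poweR => //.
  - by rewrite invr_ge0 ltW.
  - rewrite in_itv/= leey andbT; apply: integral_ge0 => t _.
    by rewrite lee_fin mulr_ge0 ?powR_ge0.
  - by rewrite in_itv/= leey andbT mule_ge0.
rewrite poweRM ?lee_fin//; apply: lee_wpmul2r; first exact: poweR_ge0.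
rewrite poweR_EFin lee_fin powRM ?powR_ge0 ?invr_ge0 ?(ltW ga0)//.
apply: ler_pM; rewrite ?powR_ge0//.
  rewrite -powRrM mulfK ?(gt_eqF r0)// -[leRHS]powRr1//.
  by apply: ler_powR; rewrite ?ler1n// gerBl ltW.
apply: (@le_trans _ _ (de^-1 `^ r^-1)%R).
  apply: ge0_ler_powR; rewrite ?nnegrE ?invr_ge0 ?(ltW r0) ?(ltW ga0) ?(ltW
    de0)//.
  by rewrite lef_pV2 ?posrE.
by apply: ler1_powR; rewrite ?invf_ge1 ?invf_le1.
Qed.

(** The truncation at height [K] makes the integral A finite. The constant [c]
    is the one of [le_integral_plateau_end]. *)
Lemma exists_dual_function f (a q de c K : R) : measurable_fun D f ->
  (1 <= q)%R -> (0 < a)%R -> (0 < de)%R -> (de <= 1 - a)%R ->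
  (0 < c)%R -> (c <= 1)%R -> (c <= a * q)%R -> (0 <= K)%R ->
  let A := \int[leb]_(t in I01) (t `^ (a * q - 1) * Num.min (f^# t) K `^ q)%:E
    in
  A < +oo /\
  exists g : T -> R,
  [/\ measurable_fun D g, forall x, D x -> (0 <= f x * g x)%R,
      mu D * ((2 `^ (1 - q) * c)%:E * A) <= \int[mu]_(x in D) (f x * g x)%:E
    & L (1 - a)%R (hoelder_conjugate q%:E) g <= (2 / de)%:E * A `^ (1 - q^-1)].
Proof.
move=> mf q1 a0 de0 dea c0 c1 caq K0 A.
have q0 : (0 < q)%R by exact: lt_le_trans q1.
have aq0 : (0 < a * q)%R by rewrite mulr_gt0.
pose F t := Num.min (f^# t) K.
have F0 t : (0 <= F t)%R by rewrite le_min drearr_ge0.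
have Fni t u : (0 < t)%R -> (t <= u)%R -> (F u <= F t)%R.
  move=> t0 tu; rewrite /F le_min ge_min (drearr_nincr mD Dfin mf t0 tu)/=.
  by rewrite ge_min lexx orbT.
have mpow b : measurable_fun I01 (fun t : R => t `^ b)%R.
  by apply: measurable_funTS; exact: measurable_powR.
have mF : measurable_fun I01 F.
  apply: nonincreasing_itv_measurable => x y.
  by rewrite !in_itv/= => /andP[x0 _] _ xy; exact: Fni.
have Afin : A < +oo.
  apply: (@le_lt_trans _ _ ((K `^ q)%:E * (1 `^ (a * q) / (a * q))%:E)).
    apply: le_trans (lee_wpmul2l _ (integral_powR_le 1 aq0)); last first.
      by rewrite lee_fin powR_ge0.
    rewrite -ge0_integralZl_EFin//; last 3 first.
    - by move=> t _; rewrite lee_fin powR_ge0.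
    - by apply/measurable_EFinP; exact: mpow.
    - exact: powR_ge0.
    apply: le_integral_ge0 => t _; first by rewrite lee_fin mulr_ge0 ?powR_ge0.
    rewrite -EFinM lee_fin mulrC; apply: ler_wpM2r; first exact: powR_ge0.
    apply: ge0_ler_powR; rewrite ?nnegrE ?(ltW q0)//; first exact: F0.
    by rewrite ge_min lexx orbT.
  by rewrite -EFinM ltry.
split => //.
have [h [h0 hni mh hlow hup]] := exists_dual_profile F0 Fni q1 a0 de0 dea Afin.
(* The minimum with [K] gives Phi(f#(t)) = h(tau(F(t))). *)
pose Phi s := h (plateau_end F (Num.min s K)).
have mPhi : measurable_fun setT Phi.
  apply: (measurableT_comp mh); apply: (measurableT_comp
    (measurable_plateau_end Fni)).
  by apply: measurable_minr.
have Phi0 s : (0 <= Phi s)%R by exact: h0.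
have mabs : measurable_fun D (fun x => `|f x|%R) by exact: measurableT_comp.
have mPhif : measurable_fun D (fun x => Phi `|f x|%R) by exact:
  measurableT_comp.
pose g x := if (f x < 0)%R then (- Phi `|f x|)%R else Phi `|f x|%R.
have fg x : (f x * g x = `|f x| * Phi `|f x|)%R.
  by rewrite /g; case: ltP => fx0; [rewrite ltr0_norm// mulrN mulNr|rewrite
    ger0_norm].
have mg : measurable_fun D g.
  apply: measurable_fun_if => //.
  - exact: measurable_fun_ltr.
  - by apply: measurable_funS (measurableT_comp (@oppr_measurable _ setT)
    mPhif) => // x [].
  - by apply: measurable_funS mPhif => // x [].
exists g; split => //.
- by move=> x Dx; rewrite fg mulr_ge0.
- under [leRHS]eq_integral do rewrite fg.
  apply: le_trans (integral_drearr_comp_le mD Dfin mf mPhi Phi0).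
  apply: lee_wpmul2l => //; rewrite EFinM -muleA.
  apply: le_trans (lee_wpmul2l _ (le_integral_plateau_end F0 Fni c0 c1 caq q0))
    _.
    by rewrite lee_fin powR_ge0.
  have mtau : measurable_fun I01 (fun t => plateau_end F (F t)).
    by apply: (measurableT_comp (measurable_plateau_end Fni)).
  rewrite -ge0_integralZl_EFin//; last 2 first.
  - by move=> t _; rewrite lee_fin mulr_ge0 ?powR_ge0.
  - apply/measurable_EFinP; apply: measurable_funM.
      exact: (measurableT_comp (measurable_powR _) mtau).
    exact: (measurableT_comp (measurable_powR _) mF).
  apply: le_integral_ge0 => t It; first by rewrite mule_ge0 ?lee_fin ?mulr_ge0
    ?powR_ge0.
  move: It; rewrite /= in_itv/= => /andP[t0 t1]; rewrite -EFinM lee_fin.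
  apply: (@le_trans _ _ (F t * Phi (f^# t))%R); last first.
    by apply: ler_wpM2r; rewrite // ge_min lexx.
  have -> : (2 `^ (1 - q) * (plateau_end F (F t) `^ (a * q - 1) * F t `^ q) =
      F t * (2 `^ (1 - q) * (plateau_end F (F t) `^ (a * q - 1) * F t `^ (q -
        1))))%R.
    by rewrite -(mulr_powRB1 (F0 t) q0); ring.
  by apply: ler_wpM2l; [exact: F0|exact: hlow].
- apply: hup => // t t0 t1.
  apply: (drearr_comp_le mD Dfin mf mg mPhi _ h0 hni _ t0 t1).
    by move=> x Dx; rewrite /g; case: ifP => _; rewrite ?normrN ger0_norm.
  move=> s s0 s1; apply: hni => //; exact: le_plateau_end.
Qed.

End lower_bound.

(** * The lower estimate and the duality *)

Section associate.
Context d (T : measurableType d) (R : realType).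
Variables (mu : {measure set T -> \bar R}) (D : set T).
Hypotheses (mD : measurable D) (Dfin : mu D < +oo).
Variables (p q theta : R).
Hypotheses (p1 : (1 < p)%R) (q1 : (1 <= q)%R) (theta0 : (0 < theta)%R).
Local Notation leb := (@lebesgue_measure R).
Local Notation I01 := (`]0%R, 1%R[%classic : set R).
Local Notation "f ^#" := (drearr mu D f) (at level 2, format "f ^#").
Local Notation q' := (hoelder_conjugate q%:E).
Local Notation p' := (hoelder_conjugate p%:E).
Local Notation N := (GLnorm mu D theta p%:E q%:E).
Local Notation Y := (GL mu D (- theta) p' q').
Local Notation M := (GLnorm mu D (- theta) p' q').
Local Notation L := (lorentz_integral mu D).
Local Notation P := (pairing_norm mu D Y M).
Local Notation K := (koethe_norm mu D Y M).
Implicit Types (f g : T -> R) (e : R).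

Let m := fine (mu D).
Let mE : mu D = m%:E. Proof. by rewrite /m fineK// ge0_fin_numE. Qed.
Let m0 : (0 <= m)%R. Proof. by rewrite -lee_fin -mE. Qed.
Let p0 : (0 < p)%R. Proof. exact: lt_trans p1. Qed.
Let q0 : (0 < q)%R. Proof. exact: lt_le_trans q1. Qed.
Let pV1 : (p^-1 < 1)%R. Proof. by rewrite invf_lt1. Qed.
Let pV0 : (0 < p^-1)%R. Proof. by rewrite invr_gt0. Qed.

(** For e <= [de], the number 1 - (1/p + e) is bounded below by [de]. *)
Let de := ((1 - p^-1) / 2)%R.
Let de0 : (0 < de)%R. Proof. by rewrite divr_gt0// subr_gt0. Qed.
Let de2 : (de + de = 1 - p^-1)%R. Proof. by rewrite /de -splitr. Qed.
Let de1 : (de < 1)%R.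
Proof. by rewrite (@lt_trans _ _ (1 - p^-1)%R)// ?gtrBl// -de2 ltrDl. Qed.

Let P0 f : 0 <= P f.
Proof. by rewrite /pairing_norm /sup_ge0 le_max lexx. Qed.

Let Cst := ((2 / de) / (m * (2 `^ (1 - q) * p^-1)))%R.

Let Cst_gt0 : (0 < m)%R -> (0 < Cst)%R.
Proof.
move=> mgt0; apply: divr_gt0; first exact: divr_gt0.
by apply: mulr_gt0 => //; apply: mulr_gt0 => //; exact: powR_gt0.
Qed.

(** If A denotes the integral, the dual function g yields
    c A <= P(f) M(g) <= C P(f) e^(-theta) A^(1 - 1/q); dividing by the finite
    number A^(1 - 1/q) bounds A^(1/q). *)
Lemma truncated_lorentz_le_pairing f e (n : R) : measurable_fun D f ->
  (0 < m)%R -> (0 < e)%R -> (e <= de)%R -> (0 <= n)%R -> P f < +oo ->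
  \int[leb]_(t in I01) (t `^ ((p^-1 + e) * q - 1) * Num.min (f^# t) n `^ q)%:E
    <=
  ((Cst * e `^ (- theta) * fine (P f)) `^ q)%:E.
Proof.
move=> mf mgt0 e0 ede n0 Pfin.
have a0 : (0 < p^-1 + e)%R by rewrite addr_gt0.
have dea : (de <= 1 - (p^-1 + e))%R.
  by rewrite opprD addrA -de2 -addrA lerDl subr_ge0.
have caq : (p^-1 <= (p^-1 + e) * q)%R.
  by rewrite (@le_trans _ _ (p^-1 + e)%R)// ?lerDl ?(ltW e0)// ler_peMr// ltW.
have [] := exists_dual_function mD Dfin mf q1 a0 de0 dea pV0 (ltW pV1) caq n0.
set A := \int[leb]_(t in I01) _.
have A0 : 0 <= A by apply: integral_ge0 => t _;
  rewrite lee_fin mulr_ge0 ?powR_ge0.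
move=> Afin [g [mg fg0 low up]].
have AE : A = (fine A)%:E by rewrite fineK// ge0_fin_numE.
set al := fine A in AE.
have al0 : (0 <= al)%R by rewrite fine_ge0.
pose rho := fine (P f).
have rhoE : P f = rho%:E by rewrite fineK// ge0_fin_numE.
have rho0 : (0 <= rho)%R by rewrite fine_ge0.
have Mg : M g <= (e `^ (- theta) * (2 / de * al `^ (1 - q^-1)))%:E.
  rewrite (dual_GLnormE mu D q p1 theta0).
  apply: (@le_trans _ _ ((e `^ (- theta))%:E * L (1 - (p^-1 + e))%R q' g)).
    apply: ereal_inf_lbound; exists e; last by [].
    by rewrite /= e0/= -de2 (le_lt_trans ede)// ltrDl.
  rewrite EFinM; apply: lee_wpmul2l; first by rewrite lee_fin powR_ge0.
  by rewrite EFinM -poweR_EFin -AE.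
have := integral_le_pairing_norm mD Dfin p1 q1 theta0 mf mg fg0 (le_lt_trans Mg
  (ltry _)).
move=> /(le_trans low) /le_trans /(_ (lee_wpmul2l (P0 f) Mg)).
rewrite -/rho rhoE AE mE -!EFinM !lee_fin => key.
have k0 : (0 < m * (2 `^ (1 - q) * p^-1))%R.
  by apply: mulr_gt0 => //; apply: mulr_gt0 => //; exact: powR_gt0.
have B0 : (0 <= Cst * e `^ (- theta) * rho)%R.
  by apply: mulr_ge0 => //; apply: mulr_ge0; [exact/ltW/Cst_gt0|exact:
    powR_ge0].
move: al0; rewrite le_eqVlt => /predU1P[<-|al0]; first exact: powR_ge0.
pose b := (al `^ (1 - q^-1))%R; pose x := (al `^ q^-1)%R.
have b0 : (0 < b)%R by exact: powR_gt0.
have alE : al = (b * x)%R.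
  by rewrite /b /x -powRD ?subrK ?powRr1 ?(ltW al0)// oner_eq0.
have alx : al = (x `^ q)%R by rewrite /x -powRrM mulVf ?(gt_eqF q0)// powRr1//
  ltW.
rewrite [leLHS]alx; apply: ge0_ler_powR; rewrite ?nnegrE ?(ltW q0) ?powR_ge0//.
rewrite -(ler_pM2r b0) -(ler_pM2l k0).
have -> : (m * (2 `^ (1 - q) * p^-1) * (x * b) = m * (2 `^ (1 - q) / p * al))%R.
  by rewrite alE; ring.
apply: (le_trans key); rewrite le_eqVlt; apply/orP; left; apply/eqP.
rewrite -/b /Cst; field.
by rewrite (gt_eqF p0) (gt_eqF mgt0) (gt_eqF de0) (gt_eqF (powR_gt0 _ _)).
Qed.

(** The sets where f# is at most n exhaust (0,1), and the truncation of f# at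
    height n does not change it there; the bound passes to the limit. *)
Lemma lorentz_le_pairing f e : measurable_fun D f -> (0 < m)%R ->
  (0 < e)%R -> (e <= de)%R ->
  (e `^ theta)%:E * L (p^-1 + e)%R q%:E f <= Cst%:E * P f.
Proof.
move=> mf mgt0 e0 ede.
have C0 := Cst_gt0 mgt0.
have [Pfin|] := ltP (P f) +oo; last first.
  by rewrite leye_eq => /eqP ->; rewrite gt0_muley ?leey.
pose rho := fine (P f).
have rhoE : P f = rho%:E by rewrite fineK// ge0_fin_numE.
have rho0 : (0 <= rho)%R by rewrite fine_ge0.
pose B := (Cst * e `^ (- theta) * rho)%R.
have B0 : (0 <= B)%R.
  by apply: mulr_ge0 => //; apply: mulr_ge0; [exact: ltW|exact: powR_ge0].
have -> : Cst%:E * P f = (e `^ theta)%:E * B%:E.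
  rewrite rhoE -!EFinM; congr (_%:E); rewrite /B powRN.
  by field; rewrite (gt_eqF (powR_gt0 _ e0)).
apply: lee_wpmul2l; first by rewrite lee_fin powR_ge0.
pose I (n : nat) := I01 `&` [set t | (f^# t <= n%:R)%R].
have mfs := measurable_drearr mD Dfin mf.
have mI n : measurable (I n).
  rewrite /I (_ : [set t | _] = f^# @^-1` `]-oo, n%:R]%classic).
    by apply: mfs => //; exact: measurable_itv.
  by apply/seteqP; split => x /=; rewrite in_itv/=.
have IE : \bigcup_n I n = I01.
  apply/seteqP; split => [t [n _ []]//|t It].
  by exists (Num.truncn (f^# t)).+1 => //; split => //=;
    rewrite ltW// truncnS_gt.
have ndI : nondecreasing_seq I.
  move=> i j ij; apply/subsetPset => t [It /= fi]; split => //=.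
  by rewrite (le_trans fi)// ler_nat.
pose G t := (t `^ ((p^-1 + e) * q - 1) * f^# t `^ q)%:E.
have G0 t : 0 <= G t by rewrite lee_fin mulr_ge0 ?powR_ge0.
have mG : measurable_fun I01 G.
  apply/measurable_EFinP; apply: measurable_funM.
    by apply: measurable_funTS; exact: measurable_powR.
  exact: (measurableT_comp (measurable_powR _) mfs).
have mGI n : measurable_fun (I n) G by apply: measurable_funS mG => // x [].
have cI := ge0_nondecreasing_set_cvg_integral (mu :=
  leb) ndI mI mGI (fun _ t _ => G0 t).
have intB : \int[leb]_(t in I01) G t <= (B `^ q)%:E.
  rewrite -IE -(cvg_lim _ cI)//; apply: lime_le.
    by apply/cvg_ex; eexists; exact: cI.
  apply: nearW => n.
  apply: le_trans (truncated_lorentz_le_pairing mf mgt0 e0 ede (ler0n _ n)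
    Pfin).
  rewrite integral_mkcond [leRHS]integral_mkcond.
  apply: le_integral_ge0 => t _; first by rewrite /patch; case: ifPn.
  rewrite /patch; case: ifPn => [/[!inE] -[It /= fn]|_].
    by rewrite mem_set// /G (min_idPl fn).
  by case: ifPn => // _; rewrite lee_fin mulr_ge0 ?powR_ge0.
rewrite (lorentz_integralE mD Dfin _ mf q0).
apply: (@le_trans _ _ ((B `^ q)%:E `^ q^-1)).
  apply: gt0_ler_poweR => //.
  - by rewrite invr_ge0 ltW.
  - by rewrite in_itv/= leey andbT; apply: integral_ge0 => t _; exact: G0.
  - by rewrite in_itv/= leey andbT lee_fin powR_ge0.
by rewrite poweR_EFin -powRrM divff ?(gt_eqF q0)// powRr1.
Qed.

(** For e > [de] one has e^theta <= 1 and t^e <= t^de, so the term of index e is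
    at most de^(-theta) times the term of index [de]. *)
Lemma GLnorm_le_pairing :
  exists2 C : R, (0 < C)%R & forall f, measurable_fun D f -> N f <= C%:E * P f.
Proof.
have [m00|mn0] := eqVneq m 0%R.
  exists 1%R => // f mf; rewrite mul1e (GLnormE mu D q p1 theta0).
  apply: ge_ereal_sup => _ [e /andP[e0 e1] <-].
  have H : L (p^-1 + e)%R q%:E f <= 0%:E * L (p^-1 + e)%R q%:E f.
    apply: lorentz_integral_le => // t t0 t1.
    by rewrite drearr0 ?mulr0 ?mul0r// mE m00.
  apply: (@le_trans _ _ ((e `^ theta)%:E * (0%:E * L (p^-1 + e)%R q%:E f))).
    by apply: lee_wpmul2l => //; rewrite lee_fin powR_ge0.
  by rewrite mul0e mule0.
have mgt0 : (0 < m)%R by rewrite lt_neqAle eq_sym mn0.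
have C0 := Cst_gt0 mgt0.
have dth1 : (1 <= de `^ (- theta))%R.
  rewrite powRN invf_ge1 ?powR_gt0//.
  apply: (@le_trans _ _ (1 `^ theta)%R); last by rewrite powR1.
  by apply: ge0_ler_powR; rewrite ?nnegrE ?(ltW theta0) ?(ltW de0) ?(ltW de1).
exists (de `^ (- theta) * Cst)%R; first by rewrite mulr_gt0 ?powR_gt0.
move=> f mf; rewrite (GLnormE mu D q p1 theta0).
apply: ge_ereal_sup => _ [e /andP[e0 e1] <-]; rewrite EFinM -muleA.
have CP0 : 0 <= Cst%:E * P f by rewrite mule_ge0// lee_fin ltW.
have [ede|dee] := leP e de.
  apply: (le_trans (lorentz_le_pairing mf mgt0 e0 ede)).
  by rewrite -[leLHS]mul1e; apply: lee_wpmul2r => //; rewrite lee_fin.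
apply: (@le_trans _ _ ((de `^ (- theta))%:E *
    ((de `^ theta)%:E * L (p^-1 + de)%R q%:E f))); last first.
  apply: lee_wpmul2l; first by rewrite lee_fin powR_ge0.
  exact: lorentz_le_pairing.
rewrite muleA -(EFinM (de `^ (- theta))).
have -> : (de `^ (- theta) * de `^ theta = 1)%R.
  by rewrite -powRD ?addNr ?powRr0// (gt_eqF de0) implybT.
have q0e : 0 < q%:E by rewrite lte_fin.
have LL : L (p^-1 + e)%R q%:E f <= 1%:E * L (p^-1 + de)%R q%:E f.
  apply: (lorentz_integral_le mD Dfin mf mf q0e ler01) => t t0 t1.
  rewrite mul1r; apply: ler_wpM2r; first exact: drearr_ge0.
  by apply: ger_powR; [rewrite t0 ltW|rewrite lerD2l ltW].
apply: le_trans LL; rewrite -[leRHS]mul1e.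
apply: lee_wpmul2r; first exact: lorentz_integral_ge0.
rewrite lee_fin; apply: (@le_trans _ _ (1 `^ theta)%R); last by rewrite powR1.
by apply: ge0_ler_powR; rewrite ?nnegrE ?(ltW theta0) ?(ltW e0) ?(ltW e1).
Qed.

Lemma GL_koethe_dual :
  norm_equiv [set f | measurable_fun D f] N P /\
  eq_space (GL mu D theta p%:E q%:E) N (koethe_dual mu D Y M) K.
Proof.
have [C C0 NP] := GLnorm_le_pairing.
have PK f := @pairing_le_koethe_norm _ _ _ mu D mD p q theta f.
have KN f (mf : measurable_fun D f) : K f <= m%:E * N f.
  by rewrite -mE; exact: koethe_norm_le.
have N0 f (mf : measurable_fun D f) : 0 <= N f.
  exact: (GLnorm_ge0 mu q p1 theta0 mf).
(* [C] serves for one of the inequalities and [m] for the other. *)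
have Cm : (0 < C + m)%R by rewrite ltr_wpDr.
have NPm f (mf : measurable_fun D f) : N f <= (C + m)%:E * P f.
  apply: (le_trans (NP f mf)); apply: lee_wpmul2r => //.
  by rewrite lee_fin lerDl.
have KNm f (mf : measurable_fun D f) : K f <= (C + m)%:E * N f.
  apply: (le_trans (KN f mf)); apply: lee_wpmul2r; first exact: N0.
  by rewrite lee_fin lerDr ltW.
have NKm f (mf : measurable_fun D f) : N f <= (C + m)%:E * K f.
  apply: (le_trans (NPm f mf)); apply: lee_wpmul2l; last exact: PK.
  by rewrite lee_fin ltW.
split.
  exists (C + m)%R => // f mf; split; first exact: NPm.
  exact: le_trans (PK f mf) (KNm f mf).
split; last by exists (C + m)%R => // f [mf _]; split; [exact: NKm|exact: KNm].
apply/seteqP; split => f [mf fin]; split => //.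
  by apply: (le_lt_trans (KNm f mf)); rewrite lte_mul_pinfty// lee_fin ltW.
apply: (le_lt_trans (NKm f mf)); rewrite lte_mul_pinfty// lee_fin ltW//.
Qed.

End associate.

Theorem theorem6p1 (R : realType) (n : nat) (Omega : set (Rn R n))
    (p q theta : R) :
  measurable Omega ->
  lebesgue_Rn R n Omega < +oo ->
  (1 < p)%R -> (1 <= q)%R -> (0 < theta)%R ->
  let mu := lebesgue_Rn R n in
  let p' := hoelder_conjugate p%:E in
  let q' := hoelder_conjugate q%:E in
  let X := GL mu Omega theta p%:E q%:E in
  let N := GLnorm mu Omega theta p%:E q%:E in
  let Y := GL mu Omega (- theta) p' q' in
  let M := GLnorm mu Omega (- theta) p' q' in
  norm_equiv [set f | measurable_fun Omega f] N (pairing_norm mu Omega Y M)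
  /\ eq_space X N (koethe_dual mu Omega Y M) (koethe_norm mu Omega Y M).
Proof. by move=> mO Ofin p1 q1 theta0; exact: GL_koethe_dual. Qed.
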